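(* Up to paratopy, there are exactly six nonassociative van Rees loops of order $27$ with at least one nontrivial nucleus (i.e. such that at least one of the left, middle and right nuclei is nontrivial).
   Context: A quasigroup is a set with a binary operation whose left translations $y\mapsto xy$ and right translations $y\mapsto yx$ are all bijections; a loop is a quasigroup with a two-sided neutral element $\varepsilon$. Quasigroups $(Q,\cdot)$ and $(P,\circ)$ are isotopic if there are bijections $\alpha,\beta,\gamma:Q\to P$ with $\alpha(x)\circ\beta(y)=\gamma(x\cdot y)$ for all $x,y$. A parastrophe (conjugate) of a quasigroup $(Q,\cdot)$ is any of the six quasigroups on $Q$ whose graph is obtained from $\{(x_1,x_2,x_3): x_1\cdot x_2=x_3\}$ by a fixed permutation of the three coordinates. Loops $Q_1,Q_2$ are paratopic if $Q_1$ is isotopic to a parastrophe of $Q_2$. A loop has exponent $3$ if it satisfies $xx\cdot x=x\cdot xx=\varepsilon$ for all $x$. A van Rees loop is a loop $Q$ such that every loop isotopic to $Q$ has exponent $3$. The left, middle and right nuclei of a loop $Q$ are $N_{\lambda}(Q)=\{a\in Q: (ax)y=a(xy)\ \forall x,y\in Q\}$, $N_{\mu}(Q)=\{a\in Q: (xa)y=x(ay)\ \forall x,y\in Q\}$, $N_{\rho}(Q)=\{a\in Q: (xy)a=x(ya)\ \forall x,y\in Q\}$; a nucleus is trivial if it equals $\{\varepsilon\}$. *)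

(* Defs.v *)
From mathcomp Require Import all_boot all_algebra all_fingroup.

Set Implicit Arguments.
Unset Strict Implicit.
Unset Printing Implicit Defensive.

Section Operations.

Variables (Q : Type) (m : Q -> Q -> Q) (e : Q).

Definition is_quasigroup : Prop :=
  (forall x, bijective (m x)) /\ (forall x, bijective (m^~ x)).

Definition is_loop : Prop := [/\ is_quasigroup, left_id e m & right_id e m].

Definition exponent3 : Prop :=
  forall x, m (m x x) x = e /\ m x (m x x) = e.

Definition left_nucleus (a : Q) : Prop :=
  forall x y, m (m a x) y = m a (m x y).

Definition middle_nucleus (a : Q) : Prop :=
  forall x y, m (m x a) y = m x (m a y).

Definition right_nucleus (a : Q) : Prop :=
  forall x y, m (m x y) a = m x (m y a).

Definition is_trivial (N : Q -> Prop) : Prop := forall a, N a <-> a = e.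

Definition has_nontrivial_nucleus : Prop :=
  [\/ ~ is_trivial left_nucleus, ~ is_trivial middle_nucleus
    | ~ is_trivial right_nucleus].

(* A triple (x_1, x_2, x_3) is a function on 'I_3 (indices shifted by one). *)
Definition graph (t : 'I_3 -> Q) : Prop := m (t 0%R) (t 1%R) = t 2%R.

End Operations.

Definition isotopic (Q P : Type) (m : Q -> Q -> Q) (n : P -> P -> P) : Prop :=
  exists alpha beta gamma : Q -> P,
    [/\ bijective alpha, bijective beta, bijective gamma
      & forall x y, n (alpha x) (beta y) = gamma (m x y)].

(* If [m] is a quasigroup operation then so is [m'], which is moreover
   determined by [m] and [s]. *)
Definition is_parastrophe (Q : Type) (m' m : Q -> Q -> Q) : Prop :=
  exists s : 'S_3, forall t : 'I_3 -> Q, graph m' t <-> graph m (t \o s).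

Definition paratopic (Q P : Type) (m : Q -> Q -> Q) (n : P -> P -> P) : Prop :=
  exists2 n' : P -> P -> P, is_parastrophe n' n & isotopic m n'.

Definition van_rees_loop (Q : Type) (m : Q -> Q -> Q) (e : Q) : Prop :=
  is_loop m e /\
  forall (P : Type) (n : P -> P -> P) (u : P),
    is_loop n u -> isotopic n m -> exponent3 n u.

(* Main.v *)
Require Import Defs.
From HB Require Import structures.
From mathcomp Require Import all_boot all_algebra all_fingroup.

(* In a van Rees loop two cells of the multiplication table lying in a common row, column or
   symbol class span a 3x3 subsquare: for all rows [r], [r'] the permutation [L_r^-1 L_r'] has
   order 3, and likewise for columns and symbols. After passing to a parastrophe, a nontrivial
   nucleus yields an autotopism [(A, id, B)], so that every loop isotope carries a fixed-point-free
   [alpha = B] of order 3 with [(alpha x) y = alpha (x y)]. Either [x (alpha y) = alpha (x y)] holds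
   throughout, or some isotope with neutral element [e] has an element [b] with
   [b (alpha e) <> alpha b]. In both cases case distinctions on a handful of products, each
   followed by the completion of all 3x3 subsquares, determine the whole table. This leaves 243
   tables in the first case and 4 in the second, and each is isotopic to a parastrophe of one of
   six explicit loops or of one of the two groups of exponent 3. The six loops are separated by
   loop identities: the [k]-th identity holds in the [k]-th loop, but in no loop isotope of a
   parastrophe of a later one. *)

Set Implicit Arguments.
Unset Strict Implicit.
Unset Printing Implicit Defensive.

(** * Names and tables *)

Inductive trit := T0 | T1 | T2.

Definition ord_of_trit (a : trit) : 'I_3 :=
  match a with T0 => inord 0 | T1 => inord 1 | T2 => inord 2 end.

Definition trit_of_ord (i : 'I_3) : trit :=
  match val i with 0 => T0 | 1 => T1 | _ => T2 end.

Lemma ord_of_tritK : cancel ord_of_trit trit_of_ord.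
Proof. by case; rewrite /trit_of_ord /= inordK. Qed.

Lemma trit_of_ordK : cancel trit_of_ord ord_of_trit.
Proof. by case=> [[|[|[|i]]] //= ilt]; apply/val_inj; rewrite /= inordK. Qed.

HB.instance Definition _ := Finite.copy trit (can_type ord_of_tritK).

Lemma card_trit : #|{: trit}| = 3.
Proof. by rewrite (bij_eq_card (Bijective ord_of_tritK trit_of_ordK)) card_ord. Qed.

Definition addt (a b : trit) : trit :=
  match a, b with
  | T0, x | x, T0 => x
  | T1, T1 => T2
  | T2, T2 => T1
  | _, _ => T0
  end.

Definition oppt (a : trit) : trit :=
  match a with T0 => T0 | T1 => T2 | T2 => T1 end.

Definition subt (a b : trit) : trit := addt a (oppt b).

Definition mult (a b : trit) : trit :=
  match a, b with
  | T0, _ | _, T0 => T0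
  | T1, x | x, T1 => x
  | T2, T2 => T1
  end.

(* The name [(o, i)] stands for [alpha^i x] where [x] represents the [o]-th orbit of [alpha]. *)
Local Notation orbit := (trit * trit)%type.
Local Notation name := (trit * trit * trit)%type.

Definition o00 : orbit := (T0, T0).
Definition e0 : name := (T0, T0, T0).

(* The generic [==] would go through [inord], too slow for the searches below. *)
Definition eqt (a b : trit) : bool :=
  match a, b with T0, T0 | T1, T1 | T2, T2 => true | _, _ => false end.

Definition eqo (x y : orbit) : bool :=
  let: (a, b) := x in let: (c, d) := y in eqt a c && eqt b d.

Definition eqn (x y : name) : bool :=
  let: (a, b) := x in let: (c, d) := y in eqo a c && eqt b d.

Lemma eqtE a b : eqt a b = (a == b).
Proof. by apply/idP/eqP; case: a; case: b. Qed.

Lemma eqoE x y : eqo x y = (x == y).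
Proof. by case: x y => [a b] [c d]; rewrite /eqo !eqtE. Qed.

Lemma eqnE x y : eqn x y = (x == y).
Proof. by case: x y => [a b] [c d]; rewrite /eqn eqoE eqtE. Qed.

Definition trits := [:: T0; T1; T2].
Definition orbits : seq orbit := [seq (k, j) | k <- trits, j <- trits].
Definition names : seq name := [seq (o, i) | o <- orbits, i <- trits].

Definition nm (k : nat) : name := nth e0 names k.

Lemma mem_trits a : a \in trits. Proof. by rewrite !inE -!eqtE; case: a. Qed.
Lemma mem_orbits o : o \in orbits.
Proof. by case: o => a b; rewrite /orbits allpairs_f ?mem_trits. Qed.
Lemma mem_names x : x \in names.
Proof. by case: x => a b; rewrite /names allpairs_f ?mem_orbits ?mem_trits. Qed.

Lemma card_name : #|{: name}| = 27.
Proof. by rewrite !card_prod card_trit. Qed.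

Definition shift (d : trit) (x : name) : name := let: (o, i) := x in (o, addt i d).
Definition base (x : name) : name := let: (o, _) := x in (o, T0).
Definition off (x : name) : trit := let: (_, i) := x in i.

Lemma addtC : commutative addt. Proof. by do 2!case. Qed.
Lemma addt0 : right_id T0 addt. Proof. by case. Qed.
Lemma addtN : right_inverse T0 oppt addt. Proof. by case. Qed.

(** Tables are ternary trees addressed by the three digits of a name, which keeps lookup and update
    fast under evaluation. *)
Inductive tri A := Tri of A & A & A.
Local Notation tab A := (tri (tri (tri A))).

Section Tables.
Variable A : Type.

Definition get1 (t : tri A) (k : trit) : A :=
  let: Tri a b c := t in match k with T0 => a | T1 => b | T2 => c end.

Definition upd1 (k : trit) (f : A -> A) (t : tri A) : tri A :=
  let: Tri a b c := t in
  match k with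
  | T0 => Tri (f a) b c
  | T1 => Tri a (f b) c
  | T2 => Tri a b (f c)
  end.

Lemma get1_upd1 k k' f t :
  get1 (upd1 k f t) k' = if k == k' then f (get1 t k') else get1 t k'.
Proof. by case: t => a b c; rewrite -eqtE; case: k; case: k'. Qed.

End Tables.

Definition get A (t : tab A) (x : name) : A :=
  let: (k, j, i) := x in get1 (get1 (get1 t k) j) i.

Definition upd A (x : name) (f : A -> A) : tab A -> tab A :=
  let: (k, j, i) := x in upd1 k (upd1 j (upd1 i f)).

Lemma get_upd A x y (f : A -> A) t :
  get (upd x f t) y = if x == y then f (get t y) else get t y.
Proof.
case: x y => [[k j] i] [[k' j'] i'] /=; rewrite !get1_upd1 !xpair_eqE.
by case: eqP => // _; rewrite get1_upd1; case: eqP => // _; rewrite get1_upd1.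
Qed.

Definition tri3 A (a : A) := Tri a a a.
Definition const_tab A (a : A) : tab A := tri3 (tri3 (tri3 a)).

Lemma get_const A (a : A) x : get (const_tab a) x = a.
Proof. by case: x => [[[] []] []]. Qed.

Definition tabulate A (f : name -> A) : tab A :=
  let t B (g : trit -> B) := Tri (g T0) (g T1) (g T2) in
  t _ (fun k => t _ (fun j => t _ (fun i => f (k, j, i)))).

Lemma get_tabulate A (f : name -> A) x : get (tabulate f) x = f x.
Proof. by case: x => [[[] []] []]. Qed.

Local Notation tab2 A := (tab (tab A)).
Definition get2 A (t : tab2 A) x y : A := get (get t x) y.
Definition set2 A x y (a : A) (t : tab2 A) : tab2 A := upd x (upd y (fun=> a)) t.

Lemma get2_set2 A x y (a : A) t x' y' :
  get2 (set2 x y a t) x' y' = if (x == x') && (y == y') then a else get2 t x' y'.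
Proof. by rewrite /get2 /set2 get_upd; case: eqP => //= _; rewrite get_upd. Qed.

(** * Completion of partial multiplication tables *)

Local Notation fct := (name * name * name)%type.

(* A partial multiplication table: [rcT], [csT] and [rsT] give the symbol, row and column of a
   cell from the other two coordinates, for one representative of each class of cells modulo
   [alpha]; [used] lists the orbits named so far. *)
Record state := State {
  rcT : tab2 (option name);
  csT : tab2 (option name);
  rsT : tab2 (option name);
  used : seq orbit;
  fresh : seq orbit }.

Inductive result := Conflict | Known | Stored of state.

Definition clash (x : name) (o : option name) : bool :=
  if o is Some y then ~~ eqn x y else false.

Definition orelse (x y : option name) : option name := if x is Some _ then x else y.

Definition obind2 (f : name -> name -> option name) (x y : option name) : option name :=
  if x is Some x' then if y is Some y' then f x' y' else None else None.

Definition cons3 (a b s : option name) (l : seq fct) : seq fct :=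
  if a is Some a' then if b is Some b' then if s is Some s' then (a', b', s') :: l
  else l else l else l.

(* The subsquare spanned by the cells [(a, b1, s1)] and [(a, b2, s2)] is
<<
        b1  b2  b3
    a   s1  s2  s3
    a1  s2  s3  s1
    a2  s3  s1  s2
>>
   [A], [B] and [C] look up a coordinate of a cell from the other two. *)
Definition complete (A B C : name -> name -> option name)
    (a b1 s1 b2 s2 : name) : seq fct :=
  let oa := Some a in let ob1 := Some b1 in let ob2 := Some b2 in
  let os1 := Some s1 in let os2 := Some s2 in
  let a1 := A b1 s2 in
  let a2 := A b2 s1 in
  let s3 := orelse (obind2 C a1 ob2) (obind2 C a2 ob1) in
  let b3 := orelse (obind2 B a1 os1) (orelse (obind2 B a2 os2) (obind2 B oa s3)) in
  let s3 := orelse s3 (obind2 C oa b3) in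
  let a1 := orelse a1 (orelse (obind2 A ob2 s3) (obind2 A b3 os1)) in
  let a2 := orelse a2 (orelse (obind2 A ob1 s3) (obind2 A b3 os2)) in
  let b3 := orelse b3 (orelse (obind2 B a1 os1) (obind2 B a2 os2)) in
  cons3 a1 ob1 os2 (cons3 a1 ob2 s3 (cons3 a1 b3 os1 (cons3 oa b3 s3
  (cons3 a2 ob1 s3 (cons3 a2 ob2 os1 (cons3 a2 b3 os2 [::])))))).

Section Search.
(* [z] tells that [x (alpha y) = alpha (x y)] holds, so that columns may be shifted as well. *)
Variable z : bool.

Definition colkey (c : name) : name := if z then base c else c.
Definition coloff (c : name) : trit := if z then off c else T0.
Definition symkey (s : name) : name := if z then base s else s.
Definition symoff (s : name) : trit := if z then off s else T0.

(** Row and symbol shift together under [alpha], and so do column and symbol when [z] holds. The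
    invariant of a class of cells is the symbol offset minus the row offset and, for [z], the column
    offset; a lookup reduces to a representative and shifts back. *)
Definition lookRC st r c : option name :=
  omap (shift (addt (off r) (coloff c))) (get2 (rcT st) (base r) (colkey c)).
Definition lookCS st c s : option name :=
  omap (shift (subt (off s) (coloff c))) (get2 (csT st) (colkey c) (base s)).
Definition lookRS st r s : option name :=
  let s' := shift (oppt (off r)) s in
  omap (shift (symoff s')) (get2 (rsT st) (base r) (symkey s')).

Definition store (f : fct) (st : state) : state :=
  let: (r, c, s) := f in
  let r0 := base r in let c0 := colkey c in
  let s0 := shift (oppt (addt (off r) (coloff c))) s in
  State (set2 r0 c0 (Some s0) (rcT st))
        (set2 c0 (base s0) (Some (shift (oppt (off s0)) r0)) (csT st))
        (set2 r0 (symkey s0) (Some (shift (oppt (symoff s0)) c0)) (rsT st))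
        (used st) (fresh st).

Definition post (f : fct) (st : state) : result :=
  let: (r, c, s) := f in
  let o := lookRC st r c in
  if [|| clash s o, clash r (lookCS st c s) | clash c (lookRS st r s)] then Conflict
  else if o is Some _ then Known else Stored (store f st).

Definition acc := option (state * seq fct).

Definition post_acc (a : acc) (f : fct) : acc :=
  if a is Some (st, q) then
    match post f st with
    | Conflict => None
    | Known => a
    | Stored st' => Some (st', f :: q)
    end
  else None.

Definition post_all : acc -> seq fct -> acc := foldl post_acc.

Definition swap3 (f : fct) : fct := let: (a, b, s) := f in (b, a, s).

Definition process_row (f : fct) (a : acc) (c2 : name) : acc :=
  let: (r, c, s) := f in
  if a is Some (st, _) then
    if lookRC st r c2 is Some s2 then
      if eqn c c2 then a else
      post_all a (complete (lookCS st) (lookRS st) (lookRC st) r c s c2 s2)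
    else a
  else None.

Definition process_col (f : fct) (a : acc) (r2 : name) : acc :=
  let: (r, c, s) := f in
  if a is Some (st, _) then
    if lookRC st r2 c is Some s2 then
      if eqn r r2 then a else
      post_all a (map swap3 (complete (lookRS st) (lookCS st)
        (fun c' r' => lookRC st r' c') c r s r2 s2))
    else a
  else None.

(* Skipping cells when [z] holds loses nothing in practice and saves time. *)
Definition process (f : fct) (a : acc) : acc :=
  let l := if z then [seq (o, T0) | o <- orbits] else names in
  let a' := foldl (process_row f) a l in if z then a' else foldl (process_col f) a' l.

(** Stopping with facts still queued is sound: the state then merely lacks some deductions. *)
Fixpoint propagate (fuel : nat) (a : acc) : option state :=
  if a is Some (st, q) then
    if fuel is k.+1 then
      if q is f :: q' then propagate k (process f (Some (st, q'))) else Some st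
    else Some st
  else None.

Definition fuel := 300.

Definition assume (fs : seq fct) (st : state) : option state :=
  propagate fuel (post_all (Some (st, [::])) fs).

(** One cell suffices for the right unit law because rows shift under [alpha]. Columns need not
    shift, so the left unit law takes three cells. *)
Definition unit_facts (o : orbit) : seq fct :=
  [:: ((o, T0), e0, (o, T0)); (e0, (o, T0), (o, T0));
      (e0, (o, T1), (o, T1)); (e0, (o, T2), (o, T2))].

Definition with_orbit (o : orbit) (F : seq orbit) (st : state) : state :=
  State (rcT st) (csT st) (rsT st) (o :: used st) F.

Definition is_used st (o : orbit) : bool := has (eqo o) (used st).

Definition unless_conflict (o : option state) (k : state -> bool) : bool :=
  if o is Some st then k st else true.

(* The product of [r] and [c] is a named element or represents a fresh orbit. The [if] is there
   because [||] evaluates both sides in call by value. *)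
Definition branch (skip : name -> bool) (r c : name) (k : state -> bool) (st : state) : bool :=
  [&& is_used st r.1, is_used st c.1,
      all (fun s => if ~~ is_used st s.1 || skip s then true
                    else unless_conflict (assume [:: (r, c, s)] st) k) names
    & match fresh st with
      | [::] => all (is_used st) orbits
      | o :: F => ~~ is_used st o &&
          unless_conflict (assume (rcons (unit_facts o) (r, c, (o, T0))) (with_orbit o F st)) k
      end].

Definition introduce (k : state -> bool) (st : state) : bool :=
  if fresh st is o :: F then
    [&& ~~ is_used st o, ~~ all (is_used st) orbits
      & unless_conflict (assume (unit_facts o) (with_orbit o F st)) k]
  else false.

Inductive instr := New | Cell of name & name.

Fixpoint run (leaf : state -> bool) (p : seq instr) : state -> bool :=
  match p with
  | [::] => leaf
  | New :: p' => introduce (run leaf p')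
  | Cell r c :: p' => fun st =>
      if lookRC st r c is Some _ then run leaf p' st
      else branch xpred0 r c (run leaf p') st
  end.

Definition empty : state :=
  let t := const_tab (const_tab None) in
  State t t t [:: o00] (behead orbits).

Definition start (k : state -> bool) : bool := unless_conflict (assume (unit_facts o00) empty) k.

End Search.

(** * Soundness of the search *)

(** The permutation [L_r^-1 L_r'] sends [c1] to [c2] and [c2] to [c3]; its cube is to be the
    identity. *)
Definition row_cycles (Q : Type) (m : Q -> Q -> Q) : Prop :=
  forall r r' c1 c2 c3,
    m r' c1 = m r c2 -> m r' c2 = m r c3 -> m r' c3 = m r c1.

Definition col_cycles (Q : Type) (m : Q -> Q -> Q) : Prop :=
  row_cycles (fun x y => m y x).

Lemma injective_onto (Q : finType) (f : Q -> Q) (y : Q) :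
  injective f -> exists x, f x = y.
Proof. by move=> fI; exists (invF fI y); rewrite f_invF. Qed.

(** Two products define the row [a1] and the column [b3], and a row cycle gives the cell where they
    meet. Two column cycles then fill the row [a2]. *)
Lemma subsquare (Q : finType) (m : Q -> Q -> Q) (a b1 b2 : Q) :
  (forall x, injective (m x)) -> (forall y, injective (m^~ y)) ->
  row_cycles m -> col_cycles m ->
  exists a1 a2 b3 s3 : Q,
    [/\ m a1 b1 = m a b2, m a1 b2 = s3, m a1 b3 = m a b1 & m a b3 = s3] /\
    [/\ m a2 b1 = s3, m a2 b2 = m a b1 & m a2 b3 = m a b2].
Proof.
move=> mI mJ rowc colc.
have [a1 Ea1] := injective_onto (m a b2) (mJ b1).
have [b3 Eb3] := injective_onto (m a1 b2) (mI a).
have [a2 Ea2] := injective_onto (m a1 b2) (mJ b1).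
have a1b3 : m a1 b3 = m a b1 by apply: rowc Ea1 _; rewrite Eb3.
have a2b2 : m a2 b2 = m a b1.
  by apply: (colc b1 b2 a a1 a2); rewrite ?Ea1 ?Ea2.
have a2b3 : m a2 b3 = m a b2.
  by apply: (colc b2 b3 a a1 a2); rewrite ?Eb3 ?a1b3 ?a2b2.
by exists a1, a2, b3, (m a1 b2).
Qed.

Fixpoint allp (A : Type) (P : A -> Prop) (l : seq A) : Prop :=
  if l is x :: l' then P x /\ allp P l' else True.

Lemma allp_map (A B : Type) (f : A -> B) (P : B -> Prop) l :
  allp P (map f l) <-> allp (fun x => P (f x)) l.
Proof. by elim: l => //= x l [IH1 IH2]; split=> -[? ?]; split; auto. Qed.

Section Complete.

Variables (Q : finType) (m : Q -> Q -> Q) (phi : name -> Q) (U : name -> Prop).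
Hypotheses (mI : forall x, injective (m x)) (mJ : forall y, injective (m^~ y)).
Hypotheses (rowc : row_cycles m) (colc : col_cycles m).

Definition fact_for (f : fct) : Prop :=
  let: (a, b, s) := f in [/\ U a, U b, U s & m (phi a) (phi b) = phi s].

Variables A B C : name -> name -> option name.
Hypothesis AP : forall b s a, A b s = Some a -> fact_for (a, b, s).
Hypothesis BP : forall a s b, B a s = Some b -> fact_for (a, b, s).
Hypothesis CP : forall a b s, C a b = Some s -> fact_for (a, b, s).

(** An absent name denotes anything, so that failed lookups need no case distinction in
    [complete_sound]. *)
Definition denotes (o : option name) (X : Q) : Prop :=
  forall v, o = Some v -> U v /\ phi v = X.

Lemma denotes_orelse o o' X : denotes o X -> denotes o' X -> denotes (orelse o o') X.
Proof. by case: o => [v|]. Qed.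

Lemma denotesA ob os X Y Z : denotes ob Y -> denotes os Z -> m X Y = Z ->
  denotes (obind2 A ob os) X.
Proof.
case: ob os => [b|//] [s|//] /(_ _ erefl)[Ub EY] /(_ _ erefl)[Us EZ] XYZ v /= /AP[Uv _ _ Ev].
by split=> //; apply: (mJ (y := Y)); rewrite /= XYZ -EZ -EY.
Qed.

Lemma denotesB oa os X Y Z : denotes oa X -> denotes os Z -> m X Y = Z ->
  denotes (obind2 B oa os) Y.
Proof.
case: oa os => [a|//] [s|//] /(_ _ erefl)[Ua EX] /(_ _ erefl)[Us EZ] XYZ v /= /BP[_ Uv _ Ev].
by split=> //; apply: (mI (x := X)); rewrite /= XYZ -EZ -EX.
Qed.

Lemma denotesC oa ob X Y Z : denotes oa X -> denotes ob Y -> m X Y = Z ->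
  denotes (obind2 C oa ob) Z.
Proof.
case: oa ob => [a|//] [b|//] /(_ _ erefl)[Ua EX] /(_ _ erefl)[Ub EY] XYZ v /= /CP[_ _ Uv Ev].
by split=> //; rewrite -Ev EX EY.
Qed.

Lemma allp_cons3 oa ob os X Y Z l : denotes oa X -> denotes ob Y -> denotes os Z ->
  m X Y = Z -> allp fact_for l -> allp fact_for (cons3 oa ob os l).
Proof.
case: oa ob os => [a|//] [b|//] [s|//] /(_ _ erefl)[Ua EX] /(_ _ erefl)[Ub EY].
by move=> /(_ _ erefl)[Us EZ] XYZ Fl /=; split=> //; split=> //; rewrite EX EY EZ.
Qed.

(** Each value bound in [complete] denotes the corresponding entry of the actual subsquare; the
    bindings are followed in their order. *)
Lemma complete_sound a b1 s1 b2 s2 :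
  fact_for (a, b1, s1) -> fact_for (a, b2, s2) ->
  allp fact_for (complete A B C a b1 s1 b2 s2).
Proof.
move=> [Ua Ub1 Us1 E1] [_ Ub2 Us2 E2].
have [X1 [X2 [Y3 [Z3 [[H1 H2 H3 H4] [H5 H6 H7]]]]]] :=
  subsquare (phi a) (phi b1) (phi b2) mI mJ rowc colc.
rewrite {}E1 {}E2 in H1 H3 H6 H7.
have var v : U v -> denotes (Some v) (phi v) by move=> Uv _ [<-].
have dA := var _ Ua; have dB1 := var _ Ub1; have dB2 := var _ Ub2.
have dS1 := var _ Us1; have dS2 := var _ Us2.
pose a1 := A b1 s2; have d1 : denotes a1 X1 := denotesA dB1 dS2 H1.
pose a2 := A b2 s1; have d2 : denotes a2 X2 := denotesA dB2 dS1 H6.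
pose s3 := orelse (obind2 C a1 (Some b2)) (obind2 C a2 (Some b1)).
have dS : denotes s3 Z3.
  by apply: denotes_orelse; [apply: denotesC d1 dB2 H2 | apply: denotesC d2 dB1 H5].
pose b3 := orelse (obind2 B a1 (Some s1))
  (orelse (obind2 B a2 (Some s2)) (obind2 B (Some a) s3)).
have dB : denotes b3 Y3.
  apply: denotes_orelse; first exact: denotesB d1 dS1 H3.
  by apply: denotes_orelse; [apply: denotesB d2 dS2 H7 | apply: denotesB dA dS H4].
pose s3' := orelse s3 (obind2 C (Some a) b3); have dS' : denotes s3' Z3.
  by apply: denotes_orelse; [ | apply: denotesC dA dB H4].
pose a1' := orelse a1 (orelse (obind2 A (Some b2) s3') (obind2 A b3 (Some s1))).
have d1' : denotes a1' X1.
  apply: denotes_orelse => //.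
  by apply: denotes_orelse; [apply: denotesA dB2 dS' H2 | apply: denotesA dB dS1 H3].
pose a2' := orelse a2 (orelse (obind2 A (Some b1) s3') (obind2 A b3 (Some s2))).
have d2' : denotes a2' X2.
  apply: denotes_orelse => //.
  by apply: denotes_orelse; [apply: denotesA dB1 dS' H5 | apply: denotesA dB dS2 H7].
pose b3' := orelse b3 (orelse (obind2 B a1' (Some s1)) (obind2 B a2' (Some s2))).
have dB' : denotes b3' Y3.
  apply: denotes_orelse => //.
  by apply: denotes_orelse; [apply: denotesB d1' dS1 H3 | apply: denotesB d2' dS2 H7].
apply: (allp_cons3 d1' dB1 dS2 H1); apply: (allp_cons3 d1' dB2 dS' H2).
apply: (allp_cons3 d1' dB' dS1 H3); apply: (allp_cons3 dA dB' dS' H4).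
apply: (allp_cons3 d2' dB1 dS' H5); apply: (allp_cons3 d2' dB2 dS1 H6).
exact: (allp_cons3 d2' dB' dS2 H7).
Qed.

End Complete.

(** What the search uses of a loop. The conditions on [alpha] split the 27 elements into nine orbits
    of length three. *)
Record model (z : bool) (Q : finType) (n : Q -> Q -> Q) (e : Q) (alpha : Q -> Q) : Prop :=
  Model {
    model_card : #|Q| = 27;
    model_inj : forall x, injective (n x);
    model_injr : forall y, injective (n^~ y);
    model_1n : left_id e n;
    model_n1 : right_id e n;
    model_rows : row_cycles n;
    model_cols : col_cycles n;
    model_alpha : forall x y, n (alpha x) y = alpha (n x y);
    model_alpha3 : forall x, alpha (alpha (alpha x)) = x;
    model_alpha_fp : forall x, alpha x <> x;
    model_central : z -> forall x y, n x (alpha y) = alpha (n x y) }.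

Section Soundness.

Variables (z : bool) (Q : finType) (n : Q -> Q -> Q) (e : Q) (alpha : Q -> Q).
Hypothesis M : model z n e alpha.

Let cardQ := model_card M.
Let nI := model_inj M.
Let nJ := model_injr M.
Let n1 := model_1n M.
Let ne := model_n1 M.
Let rowc := model_rows M.
Let colc := model_cols M.
Let alpha_n := model_alpha M.
Let alpha3 := model_alpha3 M.
Let alpha_fp := model_alpha_fp M.
Let alpha_z := model_central M.

Definition act (d : trit) (x : Q) : Q :=
  match d with T0 => x | T1 => alpha x | T2 => alpha (alpha x) end.

Lemma act_add d d' x : act d (act d' x) = act (addt d' d) x.
Proof. by case: d; case: d' => //=; rewrite ?alpha3. Qed.

Lemma act_n d x y : n (act d x) y = act d (n x y).
Proof. by case: d => //=; rewrite !alpha_n. Qed.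

Lemma act_z d x y : z -> n x (act d y) = act d (n x y).
Proof. by move=> hz; case: d => //=; rewrite !alpha_z. Qed.

Lemma act_free d d' x : act d x = act d' x -> d = d'.
Proof.
have fp2 y : alpha (alpha y) <> y.
  by move=> E; have := alpha3 y; rewrite E => /alpha_fp.
have aI y w : alpha y = alpha w -> y = w by move=> E; rewrite -(alpha3 y) E alpha3.
by case: d; case: d' => //= E;
  solve [by case: (alpha_fp E) | by case: (alpha_fp (esym E)) | by case: (fp2 _ E)
  | by case: (fp2 _ (esym E)) | by case: (alpha_fp (aI _ _ E))
  | by case: (alpha_fp (esym (aI _ _ E)))].
Qed.

Implicit Types (phi : name -> Q) (st : state) (r c s : name).

Definition named st (x : name) : Prop := is_used st x.1.

Definition fact phi st : fct -> Prop := fact_for n phi (named st).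

(** Only names of used orbits carry a meaning, so a further orbit can be interpreted later without
    disturbing the recorded cells. *)
Record interp phi st : Prop := Interp {
  interp0 : named st e0 /\ phi e0 = e;
  interp_shift : forall d x, named st x -> phi (shift d x) = act d (phi x);
  interp_inj : forall x y, named st x -> named st y -> phi x = phi y -> x = y;
  interpRC : forall r c s, lookRC z st r c = Some s -> fact phi st (r, c, s);
  interpCS : forall r c s, lookCS z st c s = Some r -> fact phi st (r, c, s);
  interpRS : forall r c s, lookRS z st r s = Some c -> fact phi st (r, c, s) }.

Lemma named_shift st d x : named st (shift d x) = named st x.
Proof. by case: x. Qed.

Lemma fact_shift phi st d r c s : interp phi st ->
  fact phi st (r, c, s) -> fact phi st (shift d r, c, shift d s).
Proof.
move=> I [Ur Uc Us E]; split; rewrite ?named_shift //.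
by rewrite !(interp_shift I) // act_n E.
Qed.

Lemma fact_shiftc phi st d r c s : z -> interp phi st ->
  fact phi st (r, c, s) -> fact phi st (r, shift d c, shift d s).
Proof.
move=> hz I [Ur Uc Us E]; split; rewrite ?named_shift //.
by rewrite !(interp_shift I) // act_z // E.
Qed.

(** Two cells with the same keys and the same offset invariant differ by a shift of rows and, for
    [z], one of columns. *)
Lemma fact_move phi st r c s r' c' s' : interp phi st -> fact phi st (r, c, s) ->
  r.1 = r'.1 -> colkey z c = colkey z c' -> s.1 = s'.1 ->
  subt s'.2 (addt r'.2 (coloff z c')) = subt s.2 (addt r.2 (coloff z c)) ->
  fact phi st (r', c', s').
Proof.
case: r c s r' c' s' => [ro ri] [co ci] [so si] [ro' ri'] [co' ci'] [so' si'] /=.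
move=> I F <- Ec <-.
have Ft (a b : trit) : b = addt a (subt b a) by case: a; case: b.
move: Ec; rewrite /colkey /coloff /=; case hz : z => /=.
- case=> <- E.
  rewrite (_ : (so, si') = shift (subt ri' ri) (shift (subt ci' ci) (so, si))).
    have -> : (ro, ri') = shift (subt ri' ri) (ro, ri) by congr pair; apply: Ft.
    apply: fact_shift => //.
    have -> : (co, ci') = shift (subt ci' ci) (co, ci) by congr pair; apply: Ft.
    exact: fact_shiftc.
  by congr pair; move: E {F Ft}; case: ri; case: ri'; case: ci; case: ci'; case: si; case: si'.
- case=> <- <- E.
  rewrite (_ : (so, si') = shift (subt ri' ri) (so, si)).
    have -> : (ro, ri') = shift (subt ri' ri) (ro, ri) by congr pair; apply: Ft.
    exact: fact_shift.
  by congr pair; move: E {F Ft}; case: ri; case: ri'; case: si; case: si'.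
Qed.

Lemma store_sound phi st f : interp phi st -> fact phi st f -> interp phi (store z f st).
Proof.
case: f => [[r c] s] I F.
have same f : fact phi (store z (r, c, s) st) f = fact phi st f by [].
case: (I) => I0 Is Ii IRC ICS IRS; split=> // [r' c' s'|r' c' s'|r' c' s'].
- rewrite same /lookRC get2_set2; case: andP => [[/eqP Er /eqP Ec] [<-]|_]; last exact: IRC.
  apply: (fact_move I F) => //; case: r r' s Er {F same} => [ro ri] [ro' ri'] [so si] //= [] //.
  move=> _; move: (coloff z c) (coloff z c') => a b.
  by case: a; case: b; case: ri; case: ri'; case: si.
- rewrite same /lookCS get2_set2; case: andP => [[/eqP Ec /eqP Es] [<-]|_]; last exact: ICS.
  apply: (fact_move I F) => //; case: r s s' Es {F same} => [ro ri] [so si] [so' si'] //= [] //.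
  move=> _; move: (coloff z c) (coloff z c') => a b.
  by case: a; case: b; case: ri; case: si; case: si'.
- rewrite same /lookRS get2_set2; case: andP => [[/eqP Er /eqP Es] [<-]|_]; last exact: IRS.
  apply: (fact_move I F) => //;
    case: r r' s s' Er Es {F same} => [ro ri] [ro' ri'] [so si] [so' si'].
  + by move=> /= [].
  + by move=> _ _; rewrite /colkey; case: z; case: c => // co ci; rewrite /= ?addt0 //=; case: ci.
  + by rewrite /symkey; case: z => _ [].
  + rewrite /symkey /symoff /colkey /coloff; case: z => _ /= []; case: c => co ci /=.
    * by case: ci; case: ri; case: ri'; case: si; case: si'.
    * by case: ri; case: ri'; case: si; case: si'.
Qed.

Definition same_orbits st st' : Prop := used st = used st' /\ fresh st = fresh st'.

Lemma fact_same phi st st' f : same_orbits st st' -> fact phi st f -> fact phi st' f.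
Proof. by case=> E _; rewrite /fact /fact_for /named /is_used E. Qed.

Lemma allp_same phi st st' l :
  same_orbits st st' -> allp (fact phi st) l -> allp (fact phi st') l.
Proof. by move=> E; elim: l => //= f l IH [Ff /IH]; split=> //; apply: (fact_same E). Qed.

(** [None] stands for a conflict, which facts that hold in the loop never produce. *)
Definition acc_ok phi st0 (a : acc) : Prop :=
  if a is Some (st, q) then
    [/\ interp phi st, same_orbits st0 st & allp (fact phi st0) q]
  else False.

Lemma clash_sound phi st x o : interp phi st -> named st x ->
  (forall y, o = Some y -> named st y /\ phi x = phi y) -> clash x o = false.
Proof.
move=> I Ux; case: o => [y /(_ y erefl)[Uy E]|] //=.
by apply/negbF; rewrite eqnE; apply/eqP; apply: (interp_inj I).
Qed.

Lemma post_acc_sound phi st0 a f :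
  acc_ok phi st0 a -> fact phi st0 f -> acc_ok phi st0 (post_acc z a f).
Proof.
case: a => [[st q]|] //= [I E Fq] Ff; have {}Ff := fact_same E Ff.
have E' : same_orbits st st0 by case: E; split.
rewrite /post; case: f Ff => [[r c] s] Ff; case: (Ff) => Ur Uc Us En.
rewrite (clash_sound I Us) => [|y /(interpRC I)[_ _ Uy <-]]; last by rewrite En.
rewrite (clash_sound I Ur) => [|y /(interpCS I)[Uy _ _ En']]; last first.
  by split=> //; apply: (nJ (y := phi c)); rewrite /= En En'.
rewrite (clash_sound I Uc) => [|y /(interpRS I)[_ Uy _ En']]; last first.
  by split=> //; apply: (nI (x := phi r)); rewrite /= En En'.
case: lookRC => [_|] //; split; [exact: store_sound | by case: E | ].
by split=> //; apply: (fact_same E').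
Qed.

Lemma post_all_sound phi st0 a fs :
  acc_ok phi st0 a -> allp (fact phi st0) fs -> acc_ok phi st0 (post_all z a fs).
Proof.
elim: fs a => //= f fs IH a Oa [Ff Ffs]; apply: IH => //; exact: post_acc_sound.
Qed.

Lemma process_row_sound phi st0 f a c2 :
  acc_ok phi st0 a -> fact phi st0 f -> acc_ok phi st0 (process_row z f a c2).
Proof.
case: f => [[r c] s]; case: a => [[st q]|] //= Oa Ff.
case E2: lookRC => [s2|//]; case: eqn => //; apply: post_all_sound => //.
case: Oa => I E _; have E' : same_orbits st st0 by case: E; split.
apply: (allp_same E'); apply: complete_sound => //.
- by move=> *; apply: (interpCS I).
- by move=> *; apply: (interpRS I).
- by move=> *; apply: (interpRC I).
- exact: (fact_same (f := (r, c, s)) E).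
- exact: (interpRC I).
Qed.

Lemma fact_swap phi st a b s :
  fact phi st (b, a, s) -> fact_for (fun x y => n y x) phi (named st) (a, b, s).
Proof. by case. Qed.

Lemma process_col_sound phi st0 f a r2 :
  acc_ok phi st0 a -> fact phi st0 f -> acc_ok phi st0 (process_col z f a r2).
Proof.
case: f => [[r c] s]; case: a => [[st q]|] //= Oa Ff.
case E2: lookRC => [s2|//]; case: eqn => //; apply: post_all_sound => //.
case: Oa => I E _; have E' : same_orbits st st0 by case: E; split.
apply: (allp_same E'); apply/allp_map.
have : allp (fact_for (fun x y => n y x) phi (named st)) (complete (lookRS z st) (lookCS z st)
    (fun c' r' => lookRC z st r' c') c r s r2 s2).
  apply: complete_sound => //.
  - by move=> *; apply: fact_swap; apply: (interpRS I).
  - by move=> *; apply: fact_swap; apply: (interpCS I).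
  - by move=> *; apply: fact_swap; apply: (interpRC I).
  - by apply: fact_swap; apply: (fact_same (f := (r, c, s)) E).
  - by apply: fact_swap; apply: (interpRC I).
by elim: complete => //= [[[x y] w] l IH] [[? ? ? ?] /IH].
Qed.

Lemma foldl_acc phi st0 (g : acc -> name -> acc) (l : seq name) a :
  (forall a x, acc_ok phi st0 a -> acc_ok phi st0 (g a x)) ->
  acc_ok phi st0 a -> acc_ok phi st0 (foldl g a l).
Proof. by move=> Hg; elim: l a => //= x l IH a Oa; apply: IH; apply: Hg. Qed.

Lemma process_sound phi st0 f a :
  acc_ok phi st0 a -> fact phi st0 f -> acc_ok phi st0 (process z f a).
Proof.
move=> Oa Ff; rewrite /process; move: (X in foldl _ a X) => l.
have rowP : acc_ok phi st0 (foldl (process_row z f) a l).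
  by apply: foldl_acc => // b x Ob; apply: process_row_sound.
case: ifP => // _; apply: foldl_acc => // b x Ob; exact: process_col_sound.
Qed.

Lemma propagate_sound phi st0 k a : acc_ok phi st0 a ->
  exists2 st, propagate z k a = Some st & interp phi st /\ same_orbits st0 st.
Proof.
elim: k a => [|k IH] [[st q]|] //= [I E Fq]; first by exists st.
case: q Fq => [|f q] /=; first by exists st.
by move=> [Ff Fq]; apply: IH; apply: process_sound.
Qed.

Lemma assume_sound phi st fs (k : state -> bool) :
  interp phi st -> allp (fact phi st) fs -> unless_conflict (assume z fs st) k ->
  exists st', [/\ interp phi st', same_orbits st st' & k st'].
Proof.
move=> I Ffs.
have Oa : acc_ok phi st (post_all z (Some (st, [::])) fs) by apply: post_all_sound.
by rewrite /assume; have [st' -> [? ?]] := propagate_sound fuel Oa; exists st'.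
Qed.

(** The 27 names inject into 27 elements, so with no fresh orbit left every product is already
    named. *)
Lemma used_all phi st : interp phi st -> all (is_used st) orbits ->
  forall v, exists2 x, named st x & phi x = v.
Proof.
move=> I /allP U v; have Un x : named st x by apply: U; apply: mem_orbits.
have phiI : injective phi by move=> x y; apply: (interp_inj I).
have := inj_card_onto phiI _ v; rewrite cardQ card_name => /(_ isT) /codomP[x ->].
by exists x.
Qed.

Lemma unused_exists phi st : interp phi st -> ~~ all (is_used st) orbits ->
  exists v, forall x, named st x -> phi x <> v.
Proof.
move=> I /allPn[o _ Uo].
pose A := [set phi x | x in [set x : name | is_used st x.1]].
have ltA : #|A| < 27.
  apply: leq_ltn_trans (leq_imset_card _ _) _; rewrite -card_name -cardsT.
  apply: proper_card; apply/properP; split; first exact: subsetT.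
  by exists (o, T0); rewrite ?inE.
have [v vA] : exists v, v \notin A.
  apply/existsP; rewrite -negb_forall; apply: contraL ltA => /forallP AT.
  by rewrite -leqNgt -cardQ -cardsT subset_leq_card //; apply/subsetP=> v _.
exists v => x Ux E; case/negP: vA; rewrite -E.
by apply: imset_f; rewrite inE.
Qed.

Lemma with_orbit_sound phi st o F v :
  interp phi st -> ~~ is_used st o -> (forall x, named st x -> phi x <> v) ->
  exists phi', [/\ interp phi' (with_orbit o F st),
    forall x, named st x -> phi' x = phi x, phi' (o, T0) = v
    & allp (fact phi' (with_orbit o F st)) (unit_facts o)].
Proof.
move=> I No Nv; case: (I) => -[U0 E0] Is Ii IRC ICS IRS.
pose phi' (x : name) := if eqo x.1 o then act x.2 v else phi x.
have old x : named st x -> phi' x = phi x.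
  rewrite /named /phi' eqoE => Ux; case: eqP => // E.
  by case/negP: No; rewrite -E.
have namedE x : named (with_orbit o F st) x -> x.1 = o \/ named st x.
  by rewrite /named /is_used /= eqoE => /orP[/eqP|]; [left | right].
have named_old x : named st x -> named (with_orbit o F st) x.
  by rewrite /named /is_used /= => ->; rewrite orbT.
have named_new i : named (with_orbit o F st) (o, i).
  by rewrite /named /is_used /= eqoE eqxx.
have phi'o i : phi' (o, i) = act i v by rewrite /phi' /= eqoE eqxx.
(* The named elements are closed under [alpha], so the whole orbit of [v] is new. *)
have Nact d x : named st x -> phi x <> act d v.
  move=> Ux E; apply: (Nv (shift (oppt d) x)); first by rewrite named_shift.
  by rewrite Is // E act_add addtN.
have fact_old f : fact phi st f -> fact phi' (with_orbit o F st) f.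
  by case: f => [[r c] s] [Ur Uc Us E]; split; auto; rewrite !old.
have phi'0 : phi' e0 = e by rewrite old.
exists phi'; split=> //; last by do !split=> //; rewrite ?phi'0 ?phi'o ?n1 ?ne //; apply: named_old.
split.
- by split=> //; apply: named_old.
- move=> d x /namedE[]; last by move=> Ux; rewrite !old ?named_shift // Is.
  by case: x => o' i /= ->; rewrite !phi'o act_add.
- move=> [o1 i1] [o2 i2] /namedE[/= ->|U1] /namedE[/= ->|U2].
  + by rewrite !phi'o => /act_free ->.
  + by rewrite phi'o old // => /esym/Nact; case.
  + by rewrite phi'o old // => /Nact; case.
  + by rewrite !old //; apply: Ii.
- by move=> r c s H; apply: fact_old; apply: IRC.
- by move=> r c s H; apply: fact_old; apply: ICS.
- by move=> r c s H; apply: fact_old; apply: IRS.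
Qed.

Lemma allp_rcons (A : Type) (P : A -> Prop) l x : allp P l -> P x -> allp P (rcons l x).
Proof. by elim: l => //= y l IH [Py /IH H] /H. Qed.

(** The given loop follows one path through the case distinctions without conflict; at its end
    stands a state that describes the loop and passes [leaf]. *)
Definition accepted (leaf : state -> bool) : Prop :=
  exists phi st, interp phi st /\ leaf st.

Lemma branch_sound phi st (skip : name -> bool) r c (k : state -> bool) (leaf : state -> bool) :
  interp phi st ->
  (forall s, named st s -> skip s -> n (phi r) (phi c) <> phi s) ->
  (forall phi' st', interp phi' st' -> k st' -> accepted leaf) ->
  branch z skip r c k st -> accepted leaf.
Proof.
move=> I skipP kP /and4P[Ur Uc H1 H2].
case: (boolP [exists x, is_used st x.1 && (phi x == n (phi r) (phi c))]) => [/existsP|].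
  move=> [s /andP[Us /eqP Es]]; move/allP/(_ s (mem_names s)): H1; rewrite Us /=.
  case: ifP => [/(skipP s Us)|_]; first by rewrite Es.
  have Ff : allp (fact phi st) [:: (r, c, s)] by [].
  by case/(assume_sound I Ff) => st' [I' _]; apply: kP I'.
move=> /existsPn new.
have Nv x : named st x -> phi x <> n (phi r) (phi c).
  by move=> Ux E; have := new x; rewrite Ux E eqxx.
case: (fresh st) H2 => [/(used_all I)/(_ (n (phi r) (phi c)))[x /Nv]|o F] //.
case/andP=> No; have [phi' [I' old Eo Fo]] := with_orbit_sound F I No Nv.
have Ff : allp (fact phi' (with_orbit o F st)) (rcons (unit_facts o) (r, c, (o, T0))).
  apply: allp_rcons => //; have upd x : named st x -> named (with_orbit o F st) x.
  by rewrite /named /is_used /= => ->; rewrite orbT.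
  split; [exact: upd | exact: upd | by rewrite /named /is_used /= eqoE eqxx | ].
  by rewrite Eo !old.
by case/(assume_sound I' Ff) => st' [I'' _]; apply: kP I''.
Qed.

(** Any unnamed element may represent the new orbit; the noncentral case takes [b]. *)
Lemma introduce_at phi st v (k : state -> bool) :
  interp phi st -> (forall x, named st x -> phi x <> v) -> introduce z k st ->
  exists phi' st', [/\ interp phi' st', k st', phi' (head o00 (fresh st), T0) = v
    & forall x, named st x -> phi' x = phi x].
Proof.
rewrite /introduce; case: (fresh st) => // o F I Nv /and3P[No _].
have [phi' [I' old Eo Fo]] := with_orbit_sound F I No Nv.
by case/(assume_sound I' Fo) => st' [I'' _ k']; exists phi', st'.
Qed.

Lemma introduce_sound phi st (k : state -> bool) (leaf : state -> bool) :
  interp phi st ->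
  (forall phi' st', interp phi' st' -> k st' -> accepted leaf) ->
  introduce z k st -> accepted leaf.
Proof.
move=> I kP H; have Nall : ~~ all (is_used st) orbits.
  by move: H; rewrite /introduce; case: (fresh st) => // o F /and3P[].
have [v Nv] := unused_exists I Nall.
by have [phi' [st' [I' k' _ _]]] := introduce_at I Nv H; apply: kP I' k'.
Qed.

Lemma run_sound leaf p phi st : interp phi st -> run z leaf p st -> accepted leaf.
Proof.
elim: p phi st => [|[|r c] p IH] phi st I /=; first by exists phi, st.
  by apply: introduce_sound I _.
case: lookRC => [_|]; first exact: IH I.
by apply: (branch_sound I) => // ? ? /IH; apply.
Qed.

Lemma interp_empty : interp (fun x => act x.2 e) empty.
Proof.
have namedE x : named empty x -> x.1 = o00.
  by rewrite /named /is_used /= orbF eqoE => /eqP.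
have none (t : tab2 (option name)) x y :
  t = const_tab (const_tab None) -> get2 t x y = None by move=> ->; rewrite /get2 !get_const.
split=> //.
- by move=> d [o i] _; rewrite /= act_add.
- by move=> [o i] [o' i'] /namedE/= -> /namedE/= -> /act_free ->.
- by move=> r c s; rewrite /lookRC none.
- by move=> r c s; rewrite /lookCS none.
- by move=> r c s; rewrite /lookRS none.
Qed.

Lemma start_sound (k leaf : state -> bool) :
  (forall phi st, interp phi st -> same_orbits empty st -> k st -> accepted leaf) ->
  start z k -> accepted leaf.
Proof.
move=> kP; have Ff : allp (fact (fun x => act x.2 e) empty) (unit_facts o00).
  by do !split=> //=; rewrite n1.
by case/(assume_sound interp_empty Ff) => st [I E]; apply: kP I E.
Qed.

Lemma central_sound leaf p : start z (run z leaf p) -> accepted leaf.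
Proof. by apply: start_sound => // phi st I _; apply: run_sound I. Qed.

(** As [b] represents the first new orbit, the assumed inequality removes one value from the first
    case distinction. *)
Lemma noncentral_sound leaf p b : n b (alpha e) <> alpha b ->
  start z (introduce z (branch z (eqn (nm 4)) (nm 3) (nm 1) (run z leaf p))) ->
  accepted leaf.
Proof.
move=> noncomm; apply: start_sound => // phi st I [Eu Ef] H.
have namedE w : named st w -> w = shift w.2 e0.
  by case: w => o i; rewrite /named /is_used -Eu /= orbF eqoE => /eqP ->; case: i.
have [U0 E0] := interp0 I.
have phiE d : phi (shift d e0) = act d e by rewrite (interp_shift I) ?E0.
(* So far only the orbit of [e] is named, and [b = alpha^d e] would give [b (alpha e) = alpha b]. *)
have Nb w : named st w -> phi w <> b.
  move=> /namedE ->; rewrite phiE => Eb; apply: noncomm; rewrite -Eb act_n n1.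
  by rewrite -[alpha e]/(act T1 e) -[RHS]/(act T1 _) !act_add addtC.
have [phi' [st' [I' k' Eb old]]] := introduce_at I Nb H.
rewrite -Ef in Eb; have Un : named st' (nm 3).
  by case/and4P: k'.
(* Here [nm 3], [nm 1] and [nm 4] name [b], [alpha e] and [alpha b]. *)
apply: (branch_sound I') k' => [w Uw|phi'' st'' I'']; last exact: run_sound I''.
rewrite eqnE => /eqP <-; rewrite -[nm 4]/(shift T1 (nm 3)) (interp_shift I') // Eb.
rewrite old -?[nm 1]/(shift T1 e0) ?phiE //.
Qed.

End Soundness.

(** * Parastrophes and loop isotopes *)

(** [ldv x z] is [x \ z] and [rdv z y] is [z / y]. Carrying both divisions makes each parastrophe a
    rearrangement of the fields. *)
Record qop T := Qop { mul : T -> T -> T; ldv : T -> T -> T; rdv : T -> T -> T }.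

Definition opq T (q : qop T) :=
  Qop (fun x y => mul q y x) (fun x z => rdv q z x) (fun z y => ldv q y z).
Definition ldq T (q : qop T) := Qop (ldv q) (mul q) (fun y z => rdv q z y).
Definition rdq T (q : qop T) := Qop (rdv q) (fun z x => ldv q x z) (mul q).

Definition par T (s : nat) (q : qop T) : qop T :=
  match s with
  | 0 => q | 1 => opq q | 2 => ldq q | 3 => opq (ldq q) | 4 => rdq q | _ => opq (rdq q)
  end.

Local Notation i0 := (0%R : 'I_3).
Local Notation i1 := (1%R : 'I_3).
Local Notation i2 := (2%R : 'I_3).

Lemma ord3P (i : 'I_3) : [\/ i = i0, i = i1 | i = i2].
Proof.
case: i => [[|[|[|i]]] lti] //; [constructor 1 | constructor 2 | constructor 3];
  exact: val_inj.
Qed.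

Definition triple (Q : Type) (x y w : Q) : 'I_3 -> Q :=
  fun i => if i == i0 then x else if i == i1 then y else w.

Section Paratopy.

(** Paratopy in a form symmetric in the three coordinates, for which composition and inversion are
    immediate. *)
Definition paratopic3 (Q P : Type) (m : Q -> Q -> Q) (n : P -> P -> P) : Prop :=
  exists (s : 'S_3) (f : 'I_3 -> Q -> P) (g : 'I_3 -> P -> Q),
    [/\ forall i, cancel (f i) (g i), forall i, cancel (g i) (f i)
      & forall t, graph m t <-> graph n (fun i => f i (t (s i)))].

Lemma bij_inv (A B : Type) (f : A -> B) :
  bijective f -> exists2 g, cancel f g & cancel g f.
Proof. by case=> g fK gK; exists g. Qed.

Lemma paratopic3_trans (A B C : Type) (a : A -> A -> A) (b : B -> B -> B) (c : C -> C -> C) :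
  paratopic3 a b -> paratopic3 b c -> paratopic3 a c.
Proof.
move=> [s [f [g [fK gK H]]]] [s' [f' [g' [fK' gK' H']]]].
exists (s' * s)%g, (fun i x => f' i (f (s' i) x)), (fun i x => g (s' i) (g' i x)).
split=> [i x|i x|t]; rewrite ?fK' ?fK ?gK ?gK' //.
by apply: (iff_trans (H t)); apply: (iff_trans (H' _)); rewrite /graph !permM.
Qed.

Lemma paratopic3_sym (A B : Type) (a : A -> A -> A) (b : B -> B -> B) :
  paratopic3 a b -> paratopic3 b a.
Proof.
move=> [s [f [g [fK gK H]]]].
exists s^-1%g, (fun i => g (s^-1%g i)), (fun i => f (s^-1%g i)).
split=> [i x|i x|t]; [exact: gK | exact: fK |].
by apply: iff_sym; apply: (iff_trans (H _)); rewrite /graph /= !permK !gK.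
Qed.

(** The required parastrophe of [b] is [a] transported along the three bijections, reindexed by
    [s^-1]. *)
Lemma paratopic3_paratopic (A B : Type) (a : A -> A -> A) (b : B -> B -> B) :
  paratopic3 a b -> paratopic a b.
Proof.
move=> [s [f [g [fK gK H]]]].
pose F j := f (s^-1%g j); pose G j := g (s^-1%g j).
have FK j : cancel (F j) (G j) by move=> x; apply: fK.
have GK j : cancel (G j) (F j) by move=> x; apply: gK.
exists (fun x y => F i2 (a (G i0 x) (G i1 y))).
- exists s => t; have := H (fun j => G j (t j)).
  rewrite /graph /G /= !permK !gK => E; apply: iff_trans _ E.
  by split=> [<-|->]; rewrite -/(G i2 _) ?FK ?GK.
- exists (F i0), (F i1), (F i2).
  by split=> [|||x y]; [exists (G i0) | exists (G i1) | exists (G i2) | rewrite !FK].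
Qed.

Lemma isotopic_paratopic3 (A B : Type) (a : A -> A -> A) (b : B -> B -> B) :
  isotopic a b -> paratopic3 a b.
Proof.
move=> [f0 [f1 [f2 [/bij_inv[g0 fK0 gK0] /bij_inv[g1 fK1 gK1] /bij_inv[g2 fK2 gK2] H]]]].
exists 1%g, (triple f0 f1 f2), (triple g0 g1 g2); split=> [i|i|t].
- by case: (ord3P i) => ->.
- by case: (ord3P i) => ->.
- by rewrite /graph !perm1 /= H; split=> [->|/(can_inj fK2)].
Qed.

Lemma isotopic_trans (A B C : Type) (a : A -> A -> A) (b : B -> B -> B) (c : C -> C -> C) :
  isotopic a b -> isotopic b c -> isotopic a c.
Proof.
move=> [f0 [f1 [f2 [b0 b1 b2 H]]]] [g0 [g1 [g2 [d0 d1 d2 K]]]].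
exists (g0 \o f0), (g1 \o f1), (g2 \o f2).
by split=> [|||x y]; try exact: bij_comp; rewrite /= K H.
Qed.

Lemma parastrophe_paratopic3 (A : Type) (a b : A -> A -> A) : is_parastrophe a b -> paratopic3 a b.
Proof. by move=> [s H]; exists s, (fun=> id), (fun=> id); split. Qed.

Lemma paratopic_paratopic3 (A B : Type) (a : A -> A -> A) (b : B -> B -> B) :
  paratopic a b -> paratopic3 a b.
Proof. by case=> b' /parastrophe_paratopic3 pb /isotopic_paratopic3 /paratopic3_trans; apply. Qed.

End Paratopy.

Record quasi (T : Type) (q : qop T) : Prop := Quasi {
  ldvK : forall x z, mul q x (ldv q x z) = z;
  mulKl : forall x y, ldv q x (mul q x y) = y;
  rdvK : forall w y, mul q (rdv q w y) y = w;
  mulKr : forall x y, rdv q (mul q x y) y = x }.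

Section Quasi.

Variable T : Type.
Implicit Type q : qop T.

Lemma quasi_opq q : quasi q -> quasi (opq q).
Proof. by case=> h1 h2 h3 h4; split=> x y /=. Qed.

Lemma rdv_ldv q : quasi q -> forall x y, rdv q x (ldv q y x) = y.
Proof. by move=> h x y; rewrite -{1}(ldvK h y x) (mulKr h). Qed.

Lemma ldv_rdv q : quasi q -> forall x y, ldv q (rdv q x y) x = y.
Proof. by move=> h x y; rewrite -{2}(rdvK h x y) (mulKl h). Qed.

Lemma quasi_ldq q : quasi q -> quasi (ldq q).
Proof.
move=> h; split=> x y /=; by rewrite ?(mulKl h) ?(ldvK h) ?(rdv_ldv h) ?(ldv_rdv h).
Qed.

Lemma quasi_rdq q : quasi q -> quasi (rdq q).
Proof.
move=> h; split=> x y /=; by rewrite ?(mulKr h) ?(rdvK h) ?(rdv_ldv h) ?(ldv_rdv h).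
Qed.

Lemma quasi_par k q : quasi q -> quasi (par k q).
Proof.
by case: k => [|[|[|[|[|k]]]]] //= h; do ?apply: quasi_opq;
  do ?[exact: quasi_ldq | exact: quasi_rdq].
Qed.

Lemma mul_inj q x : quasi q -> injective (mul q x).
Proof. by move=> h y w E; rewrite -(mulKl h x y) E (mulKl h). Qed.

Lemma mul_injr q y : quasi q -> injective ((mul q)^~ y).
Proof. by move=> h x w /= E; rewrite -(mulKr h x y) E (mulKr h). Qed.

Lemma opq_parastrophe q : quasi q -> is_parastrophe (mul (opq q)) (mul q).
Proof. by move=> h; exists (tperm i0 i1) => t; rewrite /graph /= tpermL tpermR tpermD. Qed.

Lemma ldq_parastrophe q : quasi q -> is_parastrophe (mul (ldq q)) (mul q).
Proof.
move=> h; exists (tperm i1 i2) => t; rewrite /graph /= tpermL tpermR tpermD //.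
by split=> [<-|<-]; rewrite ?(ldvK h) ?(mulKl h).
Qed.

Lemma rdq_parastrophe q : quasi q -> is_parastrophe (mul (rdq q)) (mul q).
Proof.
move=> h; exists (tperm i0 i2) => t; rewrite /graph /= tpermL tpermR tpermD //.
by split=> [<-|<-]; rewrite ?(rdvK h) ?(mulKr h).
Qed.

Lemma paratopic3_par k q : quasi q -> paratopic3 (mul (par k q)) (mul q).
Proof.
have idP : is_parastrophe (mul q) (mul q) by exists 1%g => t; rewrite /graph /= !perm1.
move=> h; have hl := quasi_ldq h; have hr := quasi_rdq h.
case: k => [|[|[|[|[|k]]]]] /=.
- exact: parastrophe_paratopic3.
- exact/parastrophe_paratopic3/opq_parastrophe.
- exact/parastrophe_paratopic3/ldq_parastrophe.
- apply: paratopic3_trans (parastrophe_paratopic3 (opq_parastrophe hl)) _.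
  exact: parastrophe_paratopic3 (ldq_parastrophe h).
- exact/parastrophe_paratopic3/rdq_parastrophe.
- apply: paratopic3_trans (parastrophe_paratopic3 (opq_parastrophe hr)) _.
  exact: parastrophe_paratopic3 (rdq_parastrophe h).
Qed.

Lemma parastrophe_par q m : quasi q -> is_parastrophe m (mul q) ->
  exists2 k, k < 6 & m =2 mul (par k q).
Proof.
move=> h [s H].
have M x y w : m x y = w <->
    mul q (triple x y w (s i0)) (triple x y w (s i1)) = triple x y w (s i2).
  exact: (H (triple x y w)).
have ne01 : s i0 <> s i1 by move/perm_inj.
have ne02 : s i0 <> s i2 by move/perm_inj.
have ne12 : s i1 <> s i2 by move/perm_inj.
(* Of the 27 combinations of images only the six permutations survive. *)
case: (ord3P (s i0)) (ord3P (s i1)) (ord3P (s i2)) => [] E0 [] E1 [] E2;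
  move: ne01 ne02 ne12 M; rewrite {H} E0 E1 E2 // => _ _ _ M.
- by exists 0 => // x y; apply/M.
- by exists 2 => // x y; apply/M; rewrite /triple /= (ldvK h).
- by exists 1 => // x y; apply/M.
- by exists 3 => // x y; apply/M; rewrite /triple /= (ldvK h).
- by exists 5 => // x y; apply/M; rewrite /triple /= (rdvK h).
- by exists 4 => // x y; apply/M; rewrite /triple /= (rdvK h).
Qed.

(** The principal isotope [(x / c0) (r0 \ y)], whose neutral element is [r0 c0]. *)
Definition loop_isotope q (r0 c0 : T) : T -> T -> T :=
  fun x y => mul q (rdv q x c0) (ldv q r0 y).

Lemma loop_isotope1 q r0 c0 : quasi q -> left_id (mul q r0 c0) (loop_isotope q r0 c0).
Proof. by move=> h y; rewrite /loop_isotope (mulKr h) (ldvK h). Qed.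

Lemma loop_isotope_r1 q r0 c0 : quasi q -> right_id (mul q r0 c0) (loop_isotope q r0 c0).
Proof. by move=> h y; rewrite /loop_isotope (mulKl h) (rdvK h). Qed.

Lemma loop_isotope_isotopic q r0 c0 : quasi q -> isotopic (loop_isotope q r0 c0) (mul q).
Proof.
move=> h; exists ((rdv q)^~ c0), (ldv q r0), id; split=> //.
- by exists ((mul q)^~ c0) => x /=; rewrite ?(rdvK h) ?(mulKr h).
- by exists (mul q r0) => x /=; rewrite ?(ldvK h) ?(mulKl h).
- by exists id.
Qed.

Lemma rdv_bij q c : quasi q -> bijective ((rdv q)^~ c).
Proof. by move=> h; exists ((mul q)^~ c) => x /=; rewrite ?(rdvK h) ?(mulKr h). Qed.

Lemma ldv_bij q r : quasi q -> bijective (ldv q r).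
Proof. by move=> h; exists (mul q r) => x /=; rewrite ?(ldvK h) ?(mulKl h). Qed.

Lemma quasi_is_quasigroup q : quasi q -> is_quasigroup (mul q).
Proof.
move=> h; split=> x.
- by exists (ldv q x) => y; rewrite ?(ldvK h) ?(mulKl h).
- by exists ((rdv q)^~ x) => y /=; rewrite ?(rdvK h) ?(mulKr h).
Qed.

End Quasi.

(* If [a x * b y = c (n x y)] in a group, the element [p] with [p * b u = b y] satisfies
   [a (n x y) = a x * p] and [b (n y w) = p * b w]. *)
Lemma isotopic_assoc (Q G : Type) (n : Q -> Q -> Q) (u : Q) (q : qop G) (a b c : Q -> G) :
  quasi q -> associative (mul q) -> left_id u n -> right_id u n -> injective c ->
  (forall x y, mul q (a x) (b y) = c (n x y)) -> associative n.
Proof.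
move=> h A n1 ne cI H x y w; apply: cI; rewrite -!H.
pose p := rdv q (b y) (b u); have Ep : mul q p (b u) = b y by rewrite (rdvK h).
have Ea v : a (n v y) = mul q (a v) p.
  by apply: (mul_injr (y := b u) h); rewrite /= H ne -A Ep H.
have Eb : b (n y w) = mul q p (b w).
  by apply: (mul_inj (x := a u) h); rewrite H n1 A -Ea n1 H.
by rewrite Ea Eb A.
Qed.

(** In a group [x \ y = x^-1 y] and [x / y = x y^-1], so every parastrophe is isotopic to the group
    or to its opposite, and [isotopic_assoc] applies. *)
Lemma paratopic3_assoc (Q G : Type) (n : Q -> Q -> Q) (u : Q) (q : qop G) (g1 : G) :
  quasi q -> associative (mul q) -> left_id g1 (mul q) -> right_id g1 (mul q) ->
  left_id u n -> right_id u n -> paratopic3 n (mul q) -> associative n.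
Proof.
move=> h A q1 qr1 n1 ne /paratopic3_paratopic[m /(parastrophe_par h)[k _ Em]].
move=> [a [b [c [_ _ /bij_inj cI H]]]].
have {}H x y : mul (par k q) (a x) (b y) = c (n x y) by rewrite -Em.
have ldE x y : ldv q x y = mul q (ldv q x g1) y.
  by apply: (mul_inj (x := x) h); rewrite A !(ldvK h) q1.
have rdE x y : rdv q x y = mul q x (rdv q g1 y).
  by apply: (mul_injr (y := y) h); rewrite /= -A !(rdvK h) qr1.
have Aop : associative (mul (opq q)) by move=> x y w /=; rewrite A.
have hop := quasi_opq h.
case: k {Em} H => [|[|[|[|[|k]]]]] /= H.
- exact: (isotopic_assoc h A n1 ne cI H).
- exact: (isotopic_assoc hop Aop n1 ne cI H).
- apply: (isotopic_assoc h A n1 ne cI (a := fun x => ldv q (a x) g1) (b := b)) => x y.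
  by rewrite -ldE.
- apply: (isotopic_assoc hop Aop n1 ne cI (a := a) (b := fun y => ldv q (b y) g1)) => x y.
  by rewrite /= -ldE.
- apply: (isotopic_assoc h A n1 ne cI (a := a) (b := fun y => rdv q g1 (b y))) => x y.
  by rewrite -rdE.
- apply: (isotopic_assoc hop Aop n1 ne cI (a := fun x => rdv q g1 (a x)) (b := b)) => x y.
  by rewrite /= -rdE.
Qed.

(** * From a nontrivial nucleus to an autotopism *)

Lemma finite_quasi (Q : finType) (n : Q -> Q -> Q) :
  is_quasigroup n -> exists2 q : qop Q, quasi q & mul q = n.
Proof.
move=> [bl br].
exists (Qop n (fun x => invF (bij_inj (bl x))) (fun w y => invF (bij_inj (br y)) w)) => //.
split=> x y /=; rewrite ?f_invF ?invF_f //.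
by rewrite (f_invF (bij_inj (br y)) x).
Qed.

Section Cycles.

Variables (T : Type) (q : qop T).
Hypothesis h : quasi q.

(** In the loop isotope at [(r, c1)] the element [x = r' c1] satisfies [x x = r' c2] and
    [x (x x) = r' c3], so exponent 3 closes the row cycle. Columns use [(x x) x] in the same way. *)
Lemma van_rees_cycles u : van_rees_loop (mul q) u ->
  row_cycles (mul q) /\ col_cycles (mul q).
Proof.
move=> [_ V]; have {}V r c : exponent3 (loop_isotope q r c) (mul q r c).
  apply: V (loop_isotope_isotopic r c h); split.
  - split=> x.
    + exact: (bij_comp ((quasi_is_quasigroup h).1 (rdv q x c)) (ldv_bij r h)).
    + exact: (bij_comp ((quasi_is_quasigroup h).2 (ldv q r x)) (rdv_bij c h)).
  - exact: loop_isotope1.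
  - exact: loop_isotope_r1.
split=> r r' c1 c2 c3 E1 E2.
- have [_] := V r c1 (mul q r' c1).
  by rewrite /loop_isotope !(mulKr h) E1 (mulKl h) E2 (mulKl h).
- have [+ _] := V c1 r (mul q c1 r').
  by rewrite /loop_isotope !(mulKl h) E1 (mulKr h) E2 (mulKr h).
Qed.

(** A converse that replaces the quantification over all loop isotopes by two finitely checkable
    conditions. *)
Lemma cycles_exponent3 (P : Type) (n : P -> P -> P) (u : P) :
  row_cycles (mul q) -> col_cycles (mul q) ->
  is_loop n u -> isotopic n (mul q) -> exponent3 n u.
Proof.
move=> rowc colc [_ n1 ne] [a [b [c [_ _ /bij_inj cI H]]]] x.
have Eu : c u = mul q (a u) (b u) by rewrite H n1.
split; apply: cI; rewrite -H Eu.
- by apply: (colc (b u) (b x) (a u) (a x) (a (n x x))); rewrite !H ?n1 ?ne.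
- by apply: (rowc (a u) (a x) (b u) (b x) (b (n x x))); rewrite !H ?n1 ?ne.
Qed.

End Cycles.

(** Columns of the left division are symbols of [q]. Their cycle lies in the subsquare spanned by
    the two cells of row [x3] that carry [s'] and [s]. *)
Lemma cycles_ldq (Q : finType) (q : qop Q) : quasi q ->
  row_cycles (mul q) -> col_cycles (mul q) ->
  row_cycles (mul (ldq q)) /\ col_cycles (mul (ldq q)).
Proof.
move=> h rowc colc; split=> /=.
- move=> r r' c1 c2 c3 E1 E2.
  have D1 : mul q r' (ldv q r' c3) = mul q r (ldv q r' c2) by rewrite E2 !(ldvK h).
  have D2 : mul q r' (ldv q r' c2) = mul q r (ldv q r' c1) by rewrite E1 !(ldvK h).
  have D3 := rowc _ _ _ _ _ D1 D2.
  by rewrite -{1}(ldvK h r' c1) D3 (mulKl h).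
- move=> s s' x1 x2 x3 E1 E2.
  have mI x : injective (mul q x) by apply: mul_inj.
  have mJ y : injective ((mul q)^~ y) by apply: mul_injr.
  have [a1 [a2 [b3 [s3 [[H1 H2 H3 H4] [H5 H6 H7]]]]]] :=
    subsquare x3 (ldv q x3 s') (ldv q x2 s') mI mJ rowc colc.
  rewrite (ldvK h) in H3 H6; rewrite E2 (ldvK h) in H1 H7.
  have Ea2 : a2 = x2 by apply: (mJ (ldv q x2 s')); rewrite /= H6 (ldvK h).
  have Eb3 : b3 = ldv q x2 s by apply: (mI x2); rewrite -{1}Ea2 H7 (ldvK h).
  have Ea1 : a1 = x1 by apply: (mJ b3); rewrite /= H3 Eb3 -E1 (ldvK h).
  by apply: (mI x1); rewrite (ldvK h) -Ea1.
Qed.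

(** Decidable membership on a finite set turns the negated triviality into a witness. *)
Lemma nontrivial_elt (Q : finType) (e : Q) (N : Q -> Prop) (b : pred Q) :
  (forall a, reflect (N a) (b a)) -> N e -> ~ is_trivial e N ->
  exists2 a, N a & a <> e.
Proof.
move=> bP Ne nt; case: (boolP [exists a, b a && (a != e)]) => [/existsP|/existsPn H].
  by case=> a /andP[/bP Na /eqP]; exists a.
case: nt => a; split=> [/bP ba|->] //; apply/eqP; apply: contraTT (H a).
by rewrite ba => ->.
Qed.

Definition row_autotopism (Q : Type) (m : Q -> Q -> Q) (A B : Q -> Q) : Prop :=
  (forall r c, m (A r) c = B (m r c)) /\ (exists r, A r <> r).

(** A left nuclear [a] gives the autotopism [(L_a, id, L_a)], a middle one [(R_a, L_a^-1, id)], a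
    right one [(id, R_a, R_a)]. Left division and the opposite bring the identity to the column
    coordinate in the last two cases. *)
Lemma nucleus_autotopism (Q : finType) (q : qop Q) (u : Q) :
  quasi q -> is_loop (mul q) u -> row_cycles (mul q) -> col_cycles (mul q) ->
  has_nontrivial_nucleus (mul q) u ->
  exists k A B, [/\ row_cycles (mul (par k q)), col_cycles (mul (par k q))
    & row_autotopism (mul (par k q)) A B].
Proof.
move=> h [_ m1 me] rowc colc [] nt.
- have bP a : reflect (left_nucleus (mul q) a)
    [forall x, forall y, mul q (mul q a x) y == mul q a (mul q x y)].
    apply: (iffP forallP) => [H x y|H x]; first by have /forallP/(_ y)/eqP := H x.
    by apply/forallP => y; rewrite H.
  have [|a Na Da] := nontrivial_elt bP _ nt; first by move=> x y; rewrite !m1.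
  exists 0, (mul q a), (mul q a); split=> //; split; first exact: Na.
  by exists u; rewrite me.
- have bP a : reflect (middle_nucleus (mul q) a)
    [forall x, forall y, mul q (mul q x a) y == mul q x (mul q a y)].
    apply: (iffP forallP) => [H x y|H x]; first by have /forallP/(_ y)/eqP := H x.
    by apply/forallP => y; rewrite H.
  have [|a Na Da] := nontrivial_elt bP _ nt; first by move=> x y; rewrite m1 me.
  have [rowl coll] := cycles_ldq h rowc colc.
  exists 2, ((mul q)^~ a), (ldv q a); split=> //; split=> [r c /=|].
  + by apply: (mul_inj (x := mul q r a) h); rewrite (ldvK h) Na !(ldvK h).
  + by exists u; rewrite /= m1.
- have bP a : reflect (right_nucleus (mul q) a)
    [forall x, forall y, mul q (mul q x y) a == mul q x (mul q y a)].
    apply: (iffP forallP) => [H x y|H x]; first by have /forallP/(_ y)/eqP := H x.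
    by apply/forallP => y; rewrite H.
  have [|a Na Da] := nontrivial_elt bP _ nt; first by move=> x y; rewrite !me.
  exists 1, ((mul q)^~ a), ((mul q)^~ a); split=> //; split=> [r c /=|].
  + by rewrite Na.
  + by exists u; rewrite /= m1.
Qed.

Section Model.

Variables (Q : finType) (q : qop Q) (A B : Q -> Q).
Hypotheses (h : quasi q) (rowc : row_cycles (mul q)) (colc : col_cycles (mul q)).
Hypothesis AB : row_autotopism (mul q) A B.
Variables r0 c0 : Q.
Let n := loop_isotope q r0 c0.
Let e := mul q r0 c0.

Lemma isotope_inj x : injective (n x).
Proof. by move=> y w /(mul_inj h)/(bij_inj (ldv_bij r0 h)). Qed.

Lemma isotope_injr y : injective (n^~ y).
Proof. by move=> x w /(mul_injr h)/(bij_inj (rdv_bij c0 h)). Qed.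

Lemma isotope_rows : row_cycles n.
Proof. by move=> r r' c1 c2 c3; apply: rowc. Qed.

Lemma isotope_cols : col_cycles n.
Proof. by move=> r r' c1 c2 c3; apply: colc. Qed.

(** The autotopism [(A, id, B)] becomes [(B, id, B)] on the isotope, since
    [A (x / c0) = (B x) / c0]. *)
Lemma isotope_alpha x y : n (B x) y = B (n x y).
Proof.
have [AB1 _] := AB; rewrite /n /loop_isotope -AB1; congr (mul q _ _).
by rewrite -{1}(rdvK h x c0) -AB1 (mulKr h).
Qed.

Lemma isotope_alpha_l x : n (B e) x = B x.
Proof. by rewrite isotope_alpha /n loop_isotope1. Qed.

(** [B] is left multiplication by [B e], so the row cycles of [e] and [B e] apply. *)
Lemma isotope_alpha3 x : B (B (B x)) = x.
Proof.
rewrite -(isotope_alpha_l (B (B x))) -[RHS](loop_isotope1 r0 c0 h x).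
by apply: (isotope_rows (c1 := x) (c2 := B x)); rewrite isotope_alpha_l /n loop_isotope1.
Qed.

(** A fixed point gives [B e = e] by cancellation, hence [B = id] and [A = id]. *)
Lemma isotope_alpha_fp x : B x <> x.
Proof.
move=> Bx; have Be : B e = e.
  by apply: (@isotope_injr x); rewrite /= isotope_alpha_l /n loop_isotope1.
have [AB1 [r []]] := AB; apply: (mul_injr (y := c0) h) => /=; rewrite AB1.
by rewrite -isotope_alpha_l Be /n loop_isotope1.
Qed.

Lemma isotope_model (z : bool) : #|Q| = 27 ->
  (z -> forall x y, n x (B y) = B (n x y)) -> model z n e B.
Proof.
move=> cardQ Bz; split=> //.
- exact: isotope_inj.
- exact: isotope_injr.
- exact: loop_isotope1.
- exact: loop_isotope_r1.
- exact: isotope_rows.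
- exact: isotope_cols.
- exact: isotope_alpha.
- exact: isotope_alpha3.
- exact: isotope_alpha_fp.
Qed.

End Model.

(** * Six loops *)

(* In a central extension of [F_3^2] by [F_3] the name [(u, x, i)] is the point [(x, u)] of [F_3^2]
   together with the fibre coordinate [i]. *)
Definition centralq (p : trit -> trit -> trit -> trit -> trit) : qop name :=
  Qop
    (fun x y => let: (u, a, i) := x in let: (v, b, j) := y in
       (addt u v, addt a b, addt (addt i j) (p a u b v)))
    (fun x w => let: (u, a, i) := x in let: (v, b, j) := w in
       let v := subt v u in let b := subt b a in
       (v, b, subt j (addt i (p a u b v))))
    (fun w y => let: (u, a, i) := w in let: (v, b, j) := y in
       let u := subt u v in let a := subt a b in
       (u, a, subt i (addt j (p a u b v)))).

(* [(b, a)] is the element [a + b i] of [F_9], and [mulg] multiplies by the generator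
   [g = 1 + i]. *)
Definition mulg (w : trit * trit) : trit * trit :=
  let: (b, a) := w in (addt a b, subt a b).

(* Modulo 8 this is [h (j - i) - h j] with [h] taking the values 0, 6, 5; the term [h j] turns the
   quasigroup twisted by [g ^ h (j - i)] into a loop. *)
Definition gexp (i j : trit) : nat :=
  match i, j with
  | T0, _ => 0
  | T1, T0 => 5 | T1, T1 => 2 | T1, T2 => 1
  | T2, T0 => 6 | T2, T1 => 7 | T2, T2 => 3
  end.

Definition addp (w w' : trit * trit) : trit * trit :=
  let: (b, a) := w in let: (d, c) := w' in (addt b d, addt a c).

Definition oppp (w : trit * trit) : trit * trit := let: (b, a) := w in (oppt b, oppt a).

(** On pairs of [k] in [F_3] and [w] in [F_9] the product of [(k, w)] and [(l, w')] is
    [(k + l, g^(gexp l k) w + w')]. Since [g^8 = 1], the right division multiplies by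
    [g^(8 - gexp l k)]. *)
Definition twistedq : qop name :=
  Qop
    (fun x y => let: (k, b, a) := x in let: (l, d, c) := y in
       let: (b, a) := addp (iter (gexp l k) mulg (b, a)) (d, c) in (addt k l, b, a))
    (fun x w => let: (k, b, a) := x in let: (l, d, c) := w in
       let l := subt l k in
       let: (d, c) := addp (d, c) (oppp (iter (gexp l k) mulg (b, a))) in (l, d, c))
    (fun w y => let: (k, b, a) := w in let: (l, d, c) := y in
       let k := subt k l in
       let: (b, a) := iter (8 - gexp l k) mulg (addp (b, a) (oppp (d, c))) in (k, b, a)).

Local Notation "a ⊕ b" := (addt a b) (at level 50, left associativity).
Local Notation "a ⊗ b" := (mult a b) (at level 40, left associativity).

(* The six loops, the Heisenberg group modulo 3 and [Z_3^3]. *)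
Definition target (i : nat) : qop name :=
  match i with
  | 0 => centralq (fun x u y v => (y ⊗ v) ⊗ (v ⊗ x ⊕ y ⊗ u))
  | 1 => twistedq
  | 2 => centralq (fun x u y v => (x ⊗ u ⊕ y ⊗ v) ⊗ (u ⊗ y ⊕ x ⊗ v))
  | 3 => centralq (fun x u y v => (x ⊗ u ⊕ y ⊗ v) ⊗ (u ⊗ y ⊕ x ⊗ v) ⊕ u ⊗ y)
  | 4 => centralq (fun x u y v => y ⊗ (subt (u ⊗ y) (x ⊗ v)))
  | 5 => centralq (fun x u y v => y ⊗ (subt (u ⊗ y) (x ⊗ v)) ⊕ u ⊗ y)
  | 6 => centralq (fun x u y v => u ⊗ y)
  | _ => centralq (fun x u y v => T0)
  end.

Inductive naming := Gen of name | Prod of name & name.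

(* The elements of the loop isotope of [q] at [(r0, c0)], named as in the searches with left
   multiplication by [a] for [alpha]. *)
Definition naming_of (q : qop name) (r0 c0 a : name) (defs : seq (orbit * naming)) : tab name :=
  let n := loop_isotope q r0 c0 in
  let add o v t :=
    upd (o, T0) (fun=> v) (upd (o, T1) (fun=> n a v) (upd (o, T2) (fun=> n a (n a v)) t)) in
  foldl (fun t d => match d.2 with
         | Gen g => add d.1 g t
         | Prod x y => add d.1 (n (get t x) (get t y)) t
         end) (add o00 (mul q r0 c0) (const_tab e0)) defs.

(* An isomorphism [f2] onto the loop isotope at [(r0, c0)] is an isotopism
   [(f2 / c0, r0 \ f2, f2)] onto [q]. *)
Definition isotopism_check (T : name -> name -> option name) (q : qop name) (r0 c0 a : name)
    (defs : seq (orbit * naming)) : bool :=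
  let f2 := naming_of q r0 c0 a defs in
  let f0 := tabulate (fun x => rdv q (get f2 x) c0) in
  let f1 := tabulate (fun y => ldv q r0 (get f2 y)) in
  all (fun x => all (fun y => eqn x y || ~~ eqn (get f2 x) (get f2 y)) names) names &&
  all (fun r => all (fun c => if T r c is Some s then
    eqn (mul q (get f0 r) (get f1 c)) (get f2 s) else false) names) names.

(** Unlike [has], this stops at the first success in call by value. *)
Fixpoint lazy_has A (p : A -> bool) s :=
  if s is x :: s' then if p x then true else lazy_has p s' else false.

Lemma lazy_hasP (A : Type) (p : A -> bool) s : lazy_has p s -> exists x, p x.
Proof. by elim: s => //= x s IH; case: ifP => [px _|_]; [exists x | exact: IH]. Qed.

(* The certificate [(i, s, r0, c0, a, b, c)] claims that a table is isomorphic to the loop isotope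
   at [(r0, c0)] of the [s]-th parastrophe of [target i], the generators being sent to [a], [b]
   and [c]. *)
Definition certificate := (nat * nat * nat * nat * nat * nat * nat)%type.

Definition orb (k : nat) : orbit := (nm (3 * k)).1.
Definition product (x y : nat) : naming := Prod (nm x) (nm y).

(** The list names the orbits in the order in which [central_script] introduces them. *)
Definition central_certificate_check st (w : certificate) : bool :=
  let: (i, s, r0, c0, a, b, c) := w in
  isotopism_check (lookRC true st) (par s (target i)) (nm r0) (nm c0) (nm a)
    [:: (orb 1, Gen (nm b)); (orb 2, product 3 3); (orb 3, Gen (nm c)); (orb 4, product 3 9);
        (orb 5, product 3 12); (orb 6, product 9 9); (orb 7, product 3 18); (orb 8, product 3 21)].

Definition noncentral_certificate_check st (w : certificate) : bool :=
  let: (i, s, r0, c0, a, b, _) := w in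
  isotopism_check (lookRC false st) (par s (target i)) (nm r0) (nm c0) (nm a)
    [:: (orb 1, Gen (nm b)); (orb 2, product 3 1); (orb 3, product 3 3); (orb 4, product 3 2);
        (orb 5, product 3 4); (orb 6, product 3 5); (orb 7, product 3 10); (orb 8, product 3 11)].

(* Found by computer search. In the central case the table is determined by the offsets of five
   products, which are the ternary digits of the index of its certificate. *)
Definition central_certificates : seq certificate :=
  [:: (7,0,0,0,1,3,9); (5,0,0,0,1,9,6); (5,0,0,0,1,18,6); (0,1,3,0,4,6,9); (0,1,0,0,1,3,9);
      (0,1,3,0,4,0,9); (0,1,3,0,5,6,9); (0,1,3,0,5,0,9); (0,1,0,0,2,3,9); (0,1,3,0,4,9,18);
      (0,1,3,0,4,9,6); (0,1,3,0,4,9,12); (0,1,3,0,5,12,9); (0,1,3,0,5,15,24); (0,1,3,0,5,9,0);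
      (5,0,0,0,1,6,18); (5,0,0,0,1,3,21); (4,0,0,0,1,3,24); (0,1,3,0,5,9,18); (0,1,3,0,5,9,12);
      (0,1,3,0,5,9,6); (5,0,0,0,1,6,9); (4,0,0,0,1,3,15); (5,0,0,0,1,3,12); (0,1,3,0,4,12,9);
      (0,1,3,0,4,9,0); (0,1,3,0,4,15,24); (0,0,0,3,5,12,0); (0,0,0,3,5,9,21); (0,0,0,3,5,15,12);
      (0,2,0,3,4,12,9); (0,2,0,3,4,12,0); (0,2,0,3,4,12,18); (3,0,0,3,5,18,12); (3,0,0,3,5,9,15);
      (2,0,0,3,5,9,0); (0,2,0,3,4,6,12); (0,2,0,0,1,3,15); (0,2,0,3,4,0,9); (3,0,0,3,5,0,18);
      (2,0,0,3,5,6,9); (3,0,0,0,2,3,18); (0,0,0,0,2,3,12); (0,0,0,3,5,0,15); (0,0,0,3,5,6,12);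
      (2,0,0,3,5,9,12); (3,0,0,3,5,9,18); (3,0,0,3,5,18,6); (0,0,0,3,5,15,6); (0,0,0,3,5,15,9);
      (0,0,0,3,5,15,21); (0,2,0,3,4,12,24); (0,2,0,3,4,9,6); (0,2,0,3,4,15,9); (0,0,0,3,4,12,0);
      (0,0,0,3,4,15,12); (0,0,0,3,4,9,21); (3,0,0,3,4,18,12); (2,0,0,3,4,9,0); (3,0,0,3,4,9,15);
      (0,2,0,3,5,12,9); (0,2,0,3,5,12,18); (0,2,0,3,5,12,0); (2,0,0,3,4,9,12); (3,0,0,3,4,18,6);
      (3,0,0,3,4,9,18); (0,2,0,3,5,12,24); (0,2,0,3,5,15,9); (0,2,0,3,5,9,6); (0,0,0,3,4,15,6);
      (0,0,0,3,4,15,21); (0,0,0,3,4,15,9); (0,2,0,3,5,6,12); (0,2,0,3,5,0,9); (0,2,0,0,2,3,15);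
      (0,0,0,0,1,3,12); (0,0,0,3,4,6,12); (0,0,0,3,4,0,15); (3,0,0,3,4,0,18); (3,0,0,0,1,3,18);
      (2,0,0,3,4,6,9); (3,0,0,3,4,9,21); (3,0,0,3,4,18,0); (2,0,0,3,4,9,15); (0,2,0,3,5,9,15);
      (0,2,0,3,5,9,21); (0,2,0,3,5,9,0); (0,0,0,3,4,15,0); (0,0,0,3,4,9,15); (0,0,0,3,4,12,18);
      (0,2,0,3,5,15,21); (0,2,0,3,5,9,12); (0,2,0,3,5,12,6); (0,0,0,3,4,12,6); (0,0,0,3,4,12,24);
      (0,0,0,3,4,12,15); (3,0,0,3,4,9,12); (2,0,0,3,4,9,6); (3,0,0,3,4,18,9); (0,0,0,0,1,3,15);
      (0,0,0,3,4,6,15); (0,0,0,3,4,0,12); (2,0,0,3,4,0,9); (3,0,0,0,1,3,9); (3,0,0,3,4,6,18);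
      (0,2,0,3,5,6,9); (0,2,0,3,5,0,12); (0,2,0,0,2,3,12); (0,1,3,0,4,6,15); (0,1,0,0,1,3,15);
      (0,1,3,0,4,0,12); (0,1,3,0,5,6,12); (0,1,3,0,5,0,15); (0,1,0,0,2,3,12); (6,0,0,0,1,3,18);
      (4,0,0,0,1,9,3); (5,0,0,0,1,18,3); (0,1,3,0,5,15,12); (0,1,3,0,5,9,21); (0,1,3,0,5,12,0);
      (4,0,0,0,1,3,18); (5,0,0,0,1,6,24); (5,0,0,0,1,3,24); (0,1,3,0,4,12,24); (0,1,3,0,4,12,6);
      (0,1,3,0,4,12,15); (5,0,0,0,1,3,9); (5,0,0,0,1,6,12); (4,0,0,0,1,3,12); (0,1,3,0,4,9,15);
      (0,1,3,0,4,15,0); (0,1,3,0,4,12,18); (0,1,3,0,5,15,21); (0,1,3,0,5,15,9); (0,1,3,0,5,15,6);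
      (0,2,0,3,4,15,12); (0,2,0,3,4,15,0); (0,2,0,3,4,15,24); (2,0,0,3,5,9,21); (3,0,0,3,5,18,24);
      (3,0,0,3,5,9,0); (0,0,0,3,5,9,0); (0,0,0,3,5,15,24); (0,0,0,3,5,12,9); (3,0,0,3,5,0,9);
      (3,0,0,3,5,6,9); (2,0,0,0,2,3,9); (0,0,0,0,2,3,9); (0,0,0,3,5,0,9); (0,0,0,3,5,6,9);
      (0,2,0,3,4,6,15); (0,2,0,0,1,3,9); (0,2,0,3,4,0,15); (0,0,0,3,5,9,6); (0,0,0,3,5,9,12);
      (0,0,0,3,5,9,18); (0,2,0,3,4,9,18); (0,2,0,3,4,15,6); (0,2,0,3,4,12,15); (3,0,0,3,5,18,21);
      (2,0,0,3,5,9,18); (3,0,0,3,5,9,6); (3,0,0,3,5,9,21); (2,0,0,3,5,9,15); (3,0,0,3,5,18,0);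
      (0,0,0,3,5,15,0); (0,0,0,3,5,12,18); (0,0,0,3,5,9,15); (0,2,0,3,4,9,15); (0,2,0,3,4,9,0);
      (0,2,0,3,4,9,21); (0,0,0,0,2,3,15); (0,0,0,3,5,0,12); (0,0,0,3,5,6,15); (0,2,0,3,4,6,9);
      (0,2,0,0,1,3,12); (0,2,0,3,4,0,12); (2,0,0,3,5,0,9); (3,0,0,3,5,6,18); (3,0,0,0,2,3,9);
      (0,2,0,3,4,15,21); (0,2,0,3,4,12,6); (0,2,0,3,4,9,12); (3,0,0,3,5,9,12); (3,0,0,3,5,18,9);
      (2,0,0,3,5,9,6); (0,0,0,3,5,12,6); (0,0,0,3,5,12,15); (0,0,0,3,5,12,24); (0,2,0,3,5,15,12);
      (0,2,0,3,5,15,24); (0,2,0,3,5,15,0); (0,0,0,3,4,9,0); (0,0,0,3,4,12,9); (0,0,0,3,4,15,24);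
      (2,0,0,3,4,9,21); (3,0,0,3,4,9,0); (3,0,0,3,4,18,24); (0,0,0,3,4,9,6); (0,0,0,3,4,9,18);
      (0,0,0,3,4,9,12); (3,0,0,3,4,18,21); (3,0,0,3,4,9,6); (2,0,0,3,4,9,18); (0,2,0,3,5,9,18);
      (0,2,0,3,5,12,15); (0,2,0,3,5,15,6); (3,0,0,3,4,0,9); (2,0,0,0,1,3,9); (3,0,0,3,4,6,9);
      (0,2,0,3,5,6,15); (0,2,0,3,5,0,15); (0,2,0,0,2,3,9); (0,0,0,0,1,3,9); (0,0,0,3,4,6,9);
      (0,0,0,3,4,0,9); (0,1,3,0,5,6,15); (0,1,3,0,5,0,12); (0,1,0,0,2,3,15); (6,0,0,0,1,3,9);
      (5,0,0,0,1,9,3); (4,0,0,0,1,18,3); (0,1,3,0,4,6,12); (0,1,0,0,1,3,12); (0,1,3,0,4,0,15);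
      (5,0,0,0,1,3,18); (4,0,0,0,1,3,21); (5,0,0,0,1,6,21); (0,1,3,0,4,15,21); (0,1,3,0,4,15,6);
      (0,1,3,0,4,15,9); (0,1,3,0,5,9,15); (0,1,3,0,5,12,18); (0,1,3,0,5,15,0); (0,1,3,0,4,15,12);
      (0,1,3,0,4,12,0); (0,1,3,0,4,9,21); (0,1,3,0,5,12,24); (0,1,3,0,5,12,15); (0,1,3,0,5,12,6);
      (4,0,0,0,1,3,9); (5,0,0,0,1,3,15); (5,0,0,0,1,6,15)].

(** A wrong index could only make the check of the certificate fail, so nothing about it has to be
    proved. *)
Definition leaf_index st : nat :=
  let offset rc :=
    if lookRC true st (nm rc.1) (nm rc.2) is Some (_, i) then
      match i with T0 => 0 | T1 => 1 | T2 => 2 end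
    else 0 in
  foldl (fun k rc => 3 * k + offset rc) 0 [:: (9, 6); (9, 15); (6, 18); (12, 3); (12, 9)].

Definition central_leaf st : bool :=
  central_certificate_check st (nth (0, 0, 0, 0, 0, 0, 0) central_certificates (leaf_index st)).

(** The first is the Heisenberg group with left multiplication by a noncentral element as [alpha];
    the others are loop isotopes of the opposite of the twisted loop. *)
Definition noncentral_certificates : seq certificate :=
  [:: (6, 0, 0, 0, 3, 9, 0); (1, 1, 0, 0, 1, 9, 0);
      (1, 1, 0, 0, 1, 18, 0); (1, 1, 0, 18, 19, 0, 0)].

Definition noncentral_leaf st : bool :=
  lazy_has (noncentral_certificate_check st) noncentral_certificates.

(** * Properties of the explicit loops by evaluation *)

Definition forall_names (p : name -> bool) : bool := all p names.

Lemma forall_namesP (p : name -> bool) : forall_names p -> forall x, p x.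
Proof. by move=> /allP H x; apply: H; apply: mem_names. Qed.

Definition quasi_check (q : qop name) : bool :=
  forall_names (fun x => forall_names (fun y =>
    [&& eqn (mul q x (ldv q x y)) y, eqn (ldv q x (mul q x y)) y,
        eqn (mul q (rdv q x y) y) x & eqn (rdv q (mul q x y) y) x])).

Lemma quasi_checkP q : quasi_check q -> quasi q.
Proof.
move=> H; split=> x y; have /forall_namesP/(_ y)/and4P[] := forall_namesP H x;
  by rewrite !eqnE => /eqP ? /eqP ? /eqP ? /eqP ?.
Qed.

Definition tabulate2 (f : name -> name -> name) : tab2 name :=
  tabulate (fun x => tabulate (f x)).

Lemma get_tabulate2 f x y : get2 (tabulate2 f) x y = f x y.
Proof. by rewrite /get2 !get_tabulate. Qed.

Definition cycle_check (q : qop name) : bool :=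
  let M := tabulate2 (mul q) in let L := tabulate2 (ldv q) in
  forall_names (fun r => forall_names (fun r' => forall_names (fun c =>
    let next c := get2 L r (get2 M r' c) in
    eqn (next (next (next c))) c))).

Lemma cycle_checkP q : quasi q -> cycle_check q -> row_cycles (mul q).
Proof.
move=> h H r r' c1 c2 c3 E1 E2.
have := forall_namesP (forall_namesP (forall_namesP H r) r') c1; cbv beta zeta.
rewrite eqnE !get_tabulate2 E1 (mulKl h) E2 (mulKl h) => /eqP E3.
by rewrite -E3 (ldvK h).
Qed.

Definition assoc_check (q : qop name) : bool :=
  let M := tabulate2 (mul q) in
  forall_names (fun x => forall_names (fun y => forall_names (fun w =>
    eqn (get2 M x (get2 M y w)) (get2 M (get2 M x y) w)))).

Lemma assoc_checkP q : assoc_check q -> associative (mul q).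
Proof.
move=> H x y w; have := forall_namesP (forall_namesP (forall_namesP H x) y) w; cbv beta zeta.
by rewrite eqnE !get_tabulate2 => /eqP.
Qed.

Definition unit_check (q : qop name) : bool :=
  forall_names (fun x => eqn (mul q e0 x) x && eqn (mul q x e0) x).

Lemma unit_checkP q : unit_check q -> left_id e0 (mul q) /\ right_id e0 (mul q).
Proof.
by move=> H; split=> x; have /andP[] := forall_namesP H x; rewrite !eqnE => /eqP ? /eqP.
Qed.

Definition all_below (k : nat) (p : nat -> bool) : bool := all p (iota 0 k).
Lemma all_belowP k p : all_below k p -> forall i, i < k -> p i.
Proof. by move=> /allP H i ik; apply: H; rewrite mem_iota. Qed.

Lemma targets_check : all_below 8 (fun i => quasi_check (target i) && unit_check (target i)).
Proof. by vm_cast_no_check (erefl true). Qed.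

(** Capping the index lets eight evaluated checks cover all natural numbers. *)
Lemma target_min i : target i = target (minn i 7).
Proof.
by case: (leqP i 7) => [/minn_idPl|/ltnW/minn_idPr] E; case: i E => [|[|[|[|[|[|[|i]]]]]]].
Qed.

Lemma target_quasi i : quasi (target i).
Proof.
rewrite target_min; apply: quasi_checkP.
have lt8 : minn i 7 < 8 by rewrite ltnS geq_minr.
by have /andP[] := all_belowP targets_check lt8.
Qed.

Lemma target_unit i : left_id e0 (mul (target i)) /\ right_id e0 (mul (target i)).
Proof.
rewrite target_min; apply: unit_checkP.
have lt8 : minn i 7 < 8 by rewrite ltnS geq_minr.
by have /andP[] := all_belowP targets_check lt8.
Qed.

Lemma targets_cycles :
  all_below 6 (fun i => cycle_check (target i) && cycle_check (opq (target i))).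
Proof. by vm_cast_no_check (erefl true). Qed.

Lemma groups_check : assoc_check (target 6) && assoc_check (target 7).
Proof. by vm_cast_no_check (erefl true). Qed.

(** * Identities separating the six loops *)

Inductive term := X | Y | Op of term & term.

Fixpoint eval (T : Type) (n : T -> T -> T) (x y : T) (t : term) : T :=
  match t with
  | X => x | Y => y | Op t1 t2 => n (eval n x y t1) (eval n x y t2)
  end.

(** Number 1 is the left inverse property, as [x x] is the inverse of [x] in exponent 3; 2 is
    commutativity, 3 flexibility, and 4 says that squaring is an endomorphism. *)
Definition identity (k : nat) : term * term :=
  match k with
  | 0 => (Op X (Op Y (Op X Y)), Op (Op X Y) (Op X Y))
  | 1 => (Op (Op X X) (Op X Y), Y)
  | 2 => (Op X Y, Op Y X)
  | 3 => (Op X (Op Y X), Op (Op X Y) X)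
  | _ => (Op (Op X X) (Op Y Y), Op (Op X Y) (Op X Y))
  end.

Definition satisfies (T : Type) (n : T -> T -> T) (p : term * term) : Prop :=
  forall x y, eval n x y p.1 = eval n x y p.2.

Definition satisfies_check (q : qop name) (p : term * term) : bool :=
  forall_names (fun x => forall_names (fun y =>
    eqn (eval (mul q) x y p.1) (eval (mul q) x y p.2))).

(* Found by a greedy covering: in each loop isotope of a parastrophe of a loop, the identities of
   the earlier loops fail at one of these pairs. *)
Definition witnesses : seq (name * name) :=
  [seq (nm p.1, nm p.2) | p <- [:: (26, 21); (8, 0); (17, 12); (0, 14); (3, 19); (8, 9); (1, 24);
    (15, 21); (11, 5); (6, 18); (12, 4); (7, 26); (7, 17); (19, 0)]].

Definition refutes (q : qop name) (p : term * term) : bool :=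
  let M := tabulate2 (mul q) in let L := tabulate2 (ldv q) in let R := tabulate2 (rdv q) in
  forall_names (fun r => forall_names (fun c =>
    let n x y := get2 M (get2 R x c) (get2 L r y) in
    lazy_has (fun w => ~~ eqn (eval n w.1 w.2 p.1) (eval n w.1 w.2 p.2)) witnesses)).

(** The range [iota k.+1 (5 - k)] consists of the later loops [k + 1] to [5]; the last loop needs no
    identity. *)
Lemma separation_check :
  all_below 5 (fun k => satisfies_check (target k) (identity k) &&
    all (fun l => all_below 6 (fun s => refutes (par s (target l)) (identity k)))
      (iota k.+1 (5 - k))).
Proof. by vm_cast_no_check (erefl true). Qed.

(** * Classification *)

Definition instr_at (r c : nat) : instr := Cell (nm r) (nm c).

(* The order of the case distinctions was found by a greedy computer search. *)
Definition central_script : seq instr :=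
  [:: New; instr_at 3 3; New; instr_at 3 9; instr_at 3 12; instr_at 9 9; instr_at 3 18;
      instr_at 3 21; instr_at 9 6; instr_at 9 15; instr_at 6 18; instr_at 12 3; instr_at 12 9].

Definition noncentral_script : seq instr :=
  [:: instr_at 3 3; instr_at 3 2; instr_at 3 4; instr_at 3 5; instr_at 3 10;
      instr_at 3 11; instr_at 6 1; instr_at 6 2; instr_at 6 21; instr_at 6 3].

Lemma central_search : start true (run true central_leaf central_script).
Proof. by vm_cast_no_check (erefl true). Qed.

Lemma noncentral_search :
  start false (introduce false
    (branch false (eqn (nm 4)) (nm 3) (nm 1) (run false noncentral_leaf noncentral_script))).
Proof. by vm_cast_no_check (erefl true). Qed.

(** The check demands a complete table, so every name is used and [phi] is a bijection; its inverse
    followed by [f0], [f1], [f2] is the isotopism. *)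
Lemma isotopism_check_sound (z : bool) (Q : finType) (n : Q -> Q -> Q) (e : Q) (alpha : Q -> Q)
    phi st q r0 c0 a defs :
  #|Q| = 27 -> interp z n e alpha phi st -> quasi q ->
  isotopism_check (lookRC z st) q r0 c0 a defs -> isotopic n (mul q).
Proof.
move=> cardQ I h; rewrite /isotopism_check; set f2 := naming_of _ _ _ _ _.
set f0 := tabulate _; set f1 := tabulate _ => /andP[/allP inj2 /allP tableP].
have f2I : injective (get f2).
  move=> x y E; have /allP/(_ y (mem_names y)) := inj2 x (mem_names x).
  by rewrite !eqnE E eqxx orbF => /eqP.
have T r c : exists s, [/\ named st r, named st c, n (phi r) (phi c) = phi s
    & mul q (get f0 r) (get f1 c) = get f2 s].
  have /allP/(_ c (mem_names c)) := tableP r (mem_names r).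
  case E: lookRC => [s|//]; rewrite eqnE => /eqP Es; exists s.
  by have [] := interpRC I E.
have phiI : injective phi.
  move=> x y; have [_ [Ux _ _ _]] := T x x; have [_ [Uy _ _ _]] := T y y.
  exact: (interp_inj I).
have [psi phiK psiK] : bijective phi by apply: inj_card_bij; rewrite // cardQ card_name.
have bij2 (f : name -> name) : injective f -> bijective (f \o psi).
  by move=> /injF_bij fB; apply: bij_comp fB _; exists phi.
exists (get f0 \o psi), (get f1 \o psi), (get f2 \o psi).
split=> [|||x y]; [| | exact: bij2 |].
- apply: bij2 => x y; rewrite !get_tabulate => /(bij_inj (rdv_bij c0 h)); exact: f2I.
- apply: bij2 => x y; rewrite !get_tabulate => /(bij_inj (ldv_bij r0 h)); exact: f2I.
- have [s [_ _ E Es]] := T (psi x) (psi y).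
  by rewrite /= Es -[in RHS](psiK x) -[in RHS](psiK y) E phiK.
Qed.

Lemma accepted_paratopic3 (z : bool) (Q : finType) (n : Q -> Q -> Q) (e : Q) (alpha : Q -> Q)
    (leaf : state -> bool) :
  #|Q| = 27 ->
  (forall st, leaf st -> exists i s r0 c0 a defs,
     isotopism_check (lookRC z st) (par s (target i)) r0 c0 a defs) ->
  accepted z n e alpha leaf -> exists i, paratopic3 n (mul (target i)).
Proof.
move=> cardQ leafP [phi [st [I /leafP[i [s [r0 [c0 [a [defs C]]]]]]]]]; exists i.
have hs := quasi_par s (target_quasi i).
apply: paratopic3_trans (isotopic_paratopic3 (isotopism_check_sound cardQ I hs C)) _.
exact: paratopic3_par (target_quasi i).
Qed.

Lemma central_leafP st : central_leaf st -> exists i s r0 c0 a defs,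
  isotopism_check (lookRC true st) (par s (target i)) r0 c0 a defs.
Proof.
rewrite /central_leaf /central_certificate_check.
case: (nth _ _ _) => [[[[[[i s] r0] c0] a] b] c] H.
by exists i, s, (nm r0), (nm c0), (nm a); eexists; exact: H.
Qed.

Lemma noncentral_leafP st : noncentral_leaf st -> exists i s r0 c0 a defs,
  isotopism_check (lookRC false st) (par s (target i)) r0 c0 a defs.
Proof.
case/lazy_hasP=> c; rewrite /noncentral_certificate_check; case: c => [[[[[[i s] r0] c0] a] b] c] H.
by exists i, s, (nm r0), (nm c0), (nm a); eexists; exact: H.
Qed.

Lemma autotopism_classification (Q : finType) (q : qop Q) (A B : Q -> Q) :
  #|Q| = 27 -> quasi q -> row_cycles (mul q) -> col_cycles (mul q) ->
  row_autotopism (mul q) A B -> exists i, paratopic3 (mul q) (mul (target i)).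
Proof.
move=> cardQ h rowc colc AB.
have [r0 _] : exists r0 : Q, true by case: AB => _ [r _]; exists r.
suff [c0 [i H]] : exists c0 i, paratopic3 (loop_isotope q r0 c0) (mul (target i)).
  exists i; apply: paratopic3_trans H; apply: paratopic3_sym; apply: isotopic_paratopic3.
  exact: loop_isotope_isotopic.
case: (boolP [forall x, forall y,
    loop_isotope q r0 r0 x (B y) == B (loop_isotope q r0 r0 x y)]) => [/forallP central|].
  have Bz : true -> forall x y, loop_isotope q r0 r0 x (B y) = B (loop_isotope q r0 r0 x y).
    by move=> _ x y; apply/eqP; have /forallP := central x.
  have M := isotope_model h rowc colc AB cardQ Bz.
  by exists r0; apply: (accepted_paratopic3 cardQ central_leafP (central_sound M central_search)).
case/forallPn=> x /forallPn[y /eqP noncentral].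
(* Moving the base column to [r0 \ y] makes [y] the neutral element. With [b] the old product of [x]
   and [y], the element [b / c0] is [x / r0], so the failure at [(x, y)] becomes one at [(b, e)]. *)
pose c0 := ldv q r0 y; have Ey : mul q r0 c0 = y by rewrite (ldvK h).
have M : model false (loop_isotope q r0 c0) (mul q r0 c0) B.
  exact: (isotope_model h rowc colc AB).
pose b := loop_isotope q r0 r0 x y.
have bB : loop_isotope q r0 c0 b (B (mul q r0 c0)) <> B b.
  by rewrite Ey => E; apply: noncentral; rewrite -/b -E /b /loop_isotope -/c0 (mulKr h).
exists c0; apply: (accepted_paratopic3 cardQ noncentral_leafP).
exact: (noncentral_sound M bB noncentral_search).
Qed.

(** * The six loops on 27 points *)

Definition index_of (x : name) : 'I_27 := cast_ord card_name (enum_rank x).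
Definition name_of (i : 'I_27) : name := enum_val (cast_ord (esym card_name) i).

Lemma index_ofK : cancel index_of name_of.
Proof. by move=> x; rewrite /name_of /index_of cast_ordK enum_rankK. Qed.

Lemma name_ofK : cancel name_of index_of.
Proof. by move=> i; rewrite /name_of /index_of enum_valK cast_ordKV. Qed.

Lemma index_of_bij : bijective index_of.
Proof. by exists name_of; [exact: index_ofK | exact: name_ofK]. Qed.

Lemma name_of_bij : bijective name_of.
Proof. by exists index_of; [exact: name_ofK | exact: index_ofK]. Qed.

Definition loop6 (i : 'I_6) (x y : 'I_27) : 'I_27 :=
  index_of (mul (target i) (name_of x) (name_of y)).

Lemma loop6_isotopic i : isotopic (loop6 i) (mul (target i)).
Proof.
have nB := name_of_bij.
by exists name_of, name_of, name_of; split=> // x y; rewrite /loop6 index_ofK.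
Qed.

Lemma loop6_van_rees i : van_rees_loop (loop6 i) (index_of e0).
Proof.
have h := target_quasi i; have [m1 me] := target_unit i.
have /andP[rows cols] := all_belowP targets_cycles (ltn_ord i).
split; first split.
- split=> x; rewrite /loop6.
  + exact: (bij_comp index_of_bij (bij_comp ((quasi_is_quasigroup h).1 _) name_of_bij)).
  + exact: (bij_comp index_of_bij (bij_comp ((quasi_is_quasigroup h).2 _) name_of_bij)).
- by move=> x; rewrite /loop6 index_ofK m1 name_ofK.
- by move=> x; rewrite /loop6 index_ofK me name_ofK.
move=> P n u loop_n iso; apply: (cycles_exponent3 (q := target i)) loop_n _.
- exact: cycle_checkP.
- exact: (cycle_checkP (quasi_opq h)).
- exact: isotopic_trans iso (loop6_isotopic i).
Qed.

(** [nm 1] generates the fibre in the central extensions and is the element [1] of [F_9] in the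
    twisted loop. *)
Definition nucleus_check (q : qop name) : bool :=
  forall_names (fun x => forall_names (fun y =>
    eqn (mul q (mul q x y) (nm 1)) (mul q x (mul q y (nm 1))))).

Definition nonassoc_check (q : qop name) : bool :=
  lazy_has (fun w : name * name * name => let: (x, y, w) := w in
      ~~ eqn (mul q x (mul q y w)) (mul q (mul q x y) w))
    [:: (nm 3, nm 3, nm 9); (nm 1, nm 9, nm 9)].

Lemma loops_check :
  all_below 6 (fun i => nucleus_check (target i) && nonassoc_check (target i)).
Proof. by vm_cast_no_check (erefl true). Qed.

Lemma loop6_nonassoc i : ~ associative (loop6 i).
Proof.
have /andP[_ /lazy_hasP[[[x y] w]]] := all_belowP loops_check (ltn_ord i).
rewrite eqnE => /eqP ne A; apply: ne.
have := A (index_of x) (index_of y) (index_of w); rewrite /loop6 !index_ofK.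
by move/(can_inj index_ofK).
Qed.

Lemma loop6_nucleus i : has_nontrivial_nucleus (loop6 i) (index_of e0).
Proof.
have /andP[nuc _] := all_belowP loops_check (ltn_ord i).
apply: Or33 => T; have : index_of (nm 1) = index_of e0.
  apply/T => x y; rewrite /loop6 !index_ofK; congr index_of; apply/eqP.
  by rewrite -eqnE; apply: (forall_namesP (forall_namesP nuc _)).
by move/(can_inj index_ofK).
Qed.

Lemma eval_morph (A B : Type) (n : A -> A -> A) (m : B -> B -> B) (f : A -> B) x y t :
  (forall x y, f (n x y) = m (f x) (f y)) -> f (eval n x y t) = eval m (f x) (f y) t.
Proof. by move=> fM; elim: t => //= t1 <- t2 <-. Qed.

Lemma eq_eval (A : Type) (n m : A -> A -> A) x y t : n =2 m -> eval n x y t = eval m x y t.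
Proof. by move=> E; elim: t => //= t1 -> t2 ->. Qed.

(** The third component of an isotopism from a loop is an isomorphism onto the principal isotope at
    the images of the neutral element, and isomorphisms preserve identities. *)
Lemma refutesP (T : Type) (n : T -> T -> T) (u : T) q p :
  quasi q -> refutes q p -> left_id u n -> right_id u n -> satisfies n p ->
  ~ isotopic n (mul q).
Proof.
move=> h R n1 ne sat [a [b [c [_ _ cB H]]]].
have := forall_namesP (forall_namesP R (a u)) (b u); cbv beta zeta.
case/lazy_hasP=> -[x y] /=; rewrite eqnE => /eqP[].
have [c' cK c'K] := cB.
have cM v w : c (n v w) = loop_isotope q (a u) (b u) (c v) (c w).
  rewrite /loop_isotope -H -{2}(ne v) -{2}(n1 w) -!H.
  by rewrite (mulKr h) (mulKl h).
have E t : eval (fun x0 y0 => get2 (tabulate2 (mul q)) (get2 (tabulate2 (rdv q)) x0 (b u))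
     (get2 (tabulate2 (ldv q)) (a u) y0)) x y t = c (eval n (c' x) (c' y) t).
  rewrite (eval_morph _ _ _ cM) !c'K; apply: eq_eval => v w.
  by rewrite !get_tabulate2.
by rewrite !E sat.
Qed.

Lemma separated (i j : 'I_6) : i < j -> ~ paratopic3 (loop6 i) (loop6 j).
Proof.
move=> lt_ij; have i5 : i < 5 by apply: leq_trans lt_ij _; rewrite -ltnS.
have /andP[/forall_namesP sat /allP ref] := all_belowP separation_check i5.
have h := target_quasi j; have [m1 me] := target_unit i.
move/paratopic3_trans/(_ (isotopic_paratopic3 (loop6_isotopic j))).
have /paratopic3_sym := isotopic_paratopic3 (loop6_isotopic i).
move=> /paratopic3_trans H /H /paratopic3_paratopic[m /(parastrophe_par h)[k k6 Em] iso].
have refk := all_belowP (ref j _) k6; apply: (refutesP (quasi_par k h) (refk _) m1 me).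
- by rewrite mem_iota lt_ij; have := ltn_ord j; case: (i : nat) i5 => [|[|[|[|[|]]]]].
- by move=> x y; apply/eqP; rewrite -eqnE; apply: (forall_namesP (sat x)).
- by case: iso => a [b [c [aB bB cB E]]]; exists a, b, c; split=> // x y; rewrite -Em.
Qed.

Theorem theorem9 :
  exists (m : 'I_6 -> 'I_27 -> 'I_27 -> 'I_27) (e : 'I_6 -> 'I_27),
    [/\ forall i, [/\ van_rees_loop (m i) (e i), ~ associative (m i)
                    & has_nontrivial_nucleus (m i) (e i)],
        forall i j, paratopic (m i) (m j) -> i = j
      & forall (Q : finType) (n : Q -> Q -> Q) (u : Q),
          #|Q| = 27 ->
          van_rees_loop n u -> ~ associative n -> has_nontrivial_nucleus n u ->
          exists i, paratopic n (m i)].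
Proof.
exists loop6, (fun=> index_of e0); split.
- move=> i; split; [exact: loop6_van_rees | exact: loop6_nonassoc | exact: loop6_nucleus].
- move=> i j /paratopic_paratopic3 ij; apply/val_inj.
  by case: (ltngtP i j) => // [/separated[] | /separated[]] //; apply: paratopic3_sym.
move=> Q n u cardQ V nonassoc nt; have [[quasi_n n1 ne] _] := V.
have [q h En] := finite_quasi quasi_n; move: V nt; rewrite -En => V nt.
have [rowc colc] := van_rees_cycles h V.
have [k [A [B [rowk colk AB]]]] := nucleus_autotopism h (proj1 V) rowc colc nt.
have hk := quasi_par k h.
have [i Hi] := autotopism_classification cardQ hk rowk colk AB.
have {}Hi := paratopic3_trans (paratopic3_sym (paratopic3_par k h)) Hi.
case: (ltnP i 6) => [lti|gei].
  exists (Ordinal lti); apply: paratopic3_paratopic; apply: paratopic3_trans Hi _.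
  exact/paratopic3_sym/isotopic_paratopic3/loop6_isotopic.
(* From index 6 on the targets are groups, and a loop paratopic to a group is associative. *)
case: nonassoc; rewrite -En; have [t1 te] := target_unit i.
apply: (paratopic3_assoc (target_quasi i) _ t1 te _ _ Hi); rewrite ?En //.
have /andP[A6 A7] := groups_check.
case: i gei {Hi t1 te} => [|[|[|[|[|[|[|i]]]]]]] // _; [exact: assoc_checkP | ].
exact: (assoc_checkP A7).
Qed.
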